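(* Let $M^n\times\mathbb{R}$ be a Riemannian cylinder with a product weight $e^{\psi(p,t)}:=e^{h(p)}\,e^{v(t)}$, where $h\in C^\infty(M)$ and $v\in C^\infty(\mathbb{R})$. Consider a two-sided, compact and connected $\psi$-minimal hypersurface $\Sigma\subset M\times\mathbb{R}$ with $\partial\Sigma\neq\emptyset$. Suppose that there is $a\in\mathbb{R}$ such that one of these conditions holds: (i) $\Sigma\subset M\times(-\infty,a]$, $v'\circ\pi\leq 0$ in $\Sigma$ and $\partial\Sigma\subset M_a$, (ii) $\Sigma\subset M\times[a,+\infty)$, $v'\circ\pi\geq 0$ in $\Sigma$ and $\partial\Sigma\subset M_a$. Then $\Sigma\subseteq M_a$ and $v'(a)=0$.
   Context: A Riemannian cylinder $M^n\times\mathbb{R}$ is the Riemannian product of a complete, connected, oriented $n$-dimensional Riemannian manifold $M$ (possibly with smooth boundary) with the standard line $\mathbb{R}$. $M_a:=M\times\{a\}$ is the horizontal slice at height $a$, and $\pi(p,t):=t$ is the height function. For a two-sided smooth hypersurface $\Sigma$ (possibly with smooth boundary $\partial\Sigma$) with unit normal $N$, the $\psi$-mean curvature is $H_\psi:=-\operatorname{div}_\Sigma N-\langle\nabla\psi,N\rangle$, and $\Sigma$ is $\psi$-minimal if $H_\psi=0$ on $\Sigma$. *)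

(* Defs.v *)
From HB Require Import structures.
From mathcomp Require Import all_boot all_order all_algebra.
From mathcomp Require Import all_classical all_reals all_analysis.

Set Implicit Arguments.
Unset Strict Implicit.
Unset Printing Implicit Defensive.

Import Order.TTheory GRing.Theory Num.Theory.
Import numFieldNormedType.Exports.

Local Open Scope classical_set_scope.
Local Open Scope ring_scope.

(** ** Smooth maps between normed spaces *)

(** For finite-dimensional [V], which is the only case used, this is the usual
    notion of a map of class C^k on the open set [U]. *)
Fixpoint Ck (R : realType) (V W : normedModType R) (k : nat) (U : set V)
    (f : V -> W) : Prop :=
  (forall x, U x -> {for x, continuous f}) /\
  match k with
  | 0 => True
  | k'.+1 => forall v, (forall x, U x -> derivable f x v) /\ Ck k' U ('D_v f)
  end.

Definition smooth_on (R : realType) (V W : normedModType R) (A : set V)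
    (f : V -> W) : Prop :=
  forall x, A x -> exists (U : set V) (fe : V -> W),
    [/\ open U, U x, forall k, Ck k U fe & forall y, A y -> U y -> f y = fe y].

(** One-sided directional derivative. The half-space below is stable under
    [x |-> x + t e_k] for [0 < t], so this makes sense for maps defined on a
    relatively open subset of it, boundary points included; for a smooth map it
    is the partial derivative of any smooth extension. *)
Definition rderive (R : realType) (V W : normedModType R) (f : V -> W)
    (x v : V) : W :=
  lim ((fun t : R => t^-1 *: (f (x + t *: v) - f x)) @ 0^'+).

Definition partial (R : realType) n (W : normedModType R)
    (f : 'rV[R]_n -> W) (x : 'rV[R]_n) (k : 'I_n) : W :=
  rderive f x (delta_mx 0 k).

(** Vectors are rows: the differential is [u |-> u *m jac f x]. *)
Definition jac (R : realType) n m (f : 'rV[R]_n -> 'rV[R]_m) (x : 'rV[R]_n) :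
    'M[R]_(n, m) :=
  \matrix_(k, l) partial f x k 0 l.

(** ** Smooth manifolds with (possibly empty) boundary *)

(** The condition bears on the coordinate of index 0 only. *)
Definition half_space (R : realType) n : set 'rV[R]_n :=
  [set x | forall i : 'I_n, val i = 0%N -> 0 <= x 0 i].

Record atlas (R : realType) (n : nat) (M : Type) := Atlas {
  chart : Type;
  dom : chart -> set M;
  coord : chart -> M -> 'rV[R]_n;
  param : chart -> 'rV[R]_n -> M
}.

Definition cod (R : realType) n (M : Type) (A : atlas R n M) (i : chart A) :
    set 'rV[R]_n :=
  coord i @` dom i.

Definition trans (R : realType) n (M : Type) (A : atlas R n M)
    (i j : chart A) (x : 'rV[R]_n) : 'rV[R]_n :=
  coord j (param i x).

Definition is_manifold (R : realType) n (M : topologicalType)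
    (A : atlas R n M) : Prop :=
  [/\ hausdorff_space M,
      @second_countable M,
      forall p, exists i : chart A, dom i p,
      forall i : chart A,
        [/\ open (dom i),
            exists2 O : set 'rV[R]_n,
              open O & cod i = @half_space R n `&` O,
            forall p, dom i p -> param i (coord i p) = p,
            {within dom i, continuous (coord i)} &
            {within cod i, continuous (param i)}] &
      forall i j : chart A,
        smooth_on (coord i @` (dom i `&` dom j)) (trans i j)].

Definition boundary (R : realType) n (M : Type) (A : atlas R n M) : set M :=
  [set p | exists2 c : chart A, dom c p &
    exists2 i : 'I_n, val i = 0%N & coord c p 0 i = 0].

Definition smooth_fun (R : realType) n (M : Type) (A : atlas R n M)
    (f : M -> R) : Prop :=
  forall i : chart A, smooth_on (cod i) (f \o param i).

Definition is_orientation (R : realType) n (M : topologicalType)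
    (A : atlas R n M) (o : chart A -> M -> R) : Prop :=
  [/\ forall i p, dom i p -> o i p = 1 \/ o i p = -1,
      forall i, {within dom i, continuous (o i)} &
      forall i j p, dom i p -> dom j p ->
        o j p = Num.sg (\det (jac (trans i j) (coord i p))) * o i p].

(** ** Riemannian metrics *)

(** [g i x] is the Gram matrix of the coordinate frame of the chart [i] at the
    point of coordinates [x]. *)
Definition metric (R : realType) n (M : Type) (A : atlas R n M) :=
  chart A -> 'rV[R]_n -> 'M[R]_n.

Definition inner (R : realType) n (G : 'M[R]_n) (u w : 'rV[R]_n) : R :=
  (u *m G *m w^T) 0 0.

Definition is_riemannian (R : realType) n (M : Type) (A : atlas R n M)
    (g : metric A) : Prop :=
  [/\ forall i, smooth_on (cod i) (g i),
      forall i x, cod i x -> (g i x)^T = g i x,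
      forall i x, cod i x -> forall u, u != 0 -> 0 < inner (g i x) u u &
      forall i j p, dom i p -> dom j p ->
        let J := jac (trans i j) (coord i p) in
        g i (coord i p) = J *m g j (coord j p) *m J^T].

Definition piecewise_smooth (R : realType) n (M : topologicalType)
    (A : atlas R n M) (gam : R -> M) : Prop :=
  {within `[0, 1], continuous gam} /\
  exists (k : nat) (tau : nat -> R),
    [/\ tau 0%N = 0, tau k = 1 &
        forall l, (l < k)%N -> tau l < tau l.+1 /\
          forall i : chart A,
            smooth_on [set t | tau l <= t <= tau l.+1 /\ dom i (gam t)]
                      (coord i \o gam)].

Definition is_speed (R : realType) n (M : Type) (A : atlas R n M)
    (g : metric A) (gam : R -> M) (sigma : R -> R) : Prop :=
  forall t, 0 <= t < 1 -> forall i : chart A, dom i (gam t) ->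
    let w := rderive (coord i \o gam) t 1 in
    sigma t = Num.sqrt (inner (g i (coord i (gam t))) w w).

Definition curve_length (R : realType) n (M : topologicalType)
    (A : atlas R n M) (g : metric A) (p q : M) (L : R) : Prop :=
  exists (gam : R -> M) (sigma : R -> R),
    [/\ piecewise_smooth A gam, gam 0 = p, gam 1 = q, is_speed g gam sigma &
        L = Rintegral lebesgue_measure `[0, 1] sigma].

Definition rdist (R : realType) n (M : topologicalType)
    (A : atlas R n M) (g : metric A) (p q : M) : \bar R :=
  ereal_inf [set L%:E | L in curve_length g p q].

Definition riemannian_complete (R : realType) n (M : topologicalType)
    (A : atlas R n M) (g : metric A) : Prop :=
  forall u : nat -> M,
    (forall e : R, 0 < e -> exists N, forall k l, (N <= k)%N -> (N <= l)%N ->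
      (rdist g (u k) (u l) < e%:E)%E) ->
    exists p, forall e : R, 0 < e -> exists N, forall k, (N <= k)%N ->
      (rdist g (u k) p < e%:E)%E.

(** ** The Riemannian cylinder M x R *)

Definition cyl_atlas (R : realType) n (M : Type) (A : atlas R n M) :
    atlas R (n + 1) (M * R) :=
  {| chart := chart A;
     dom := fun i => [set q | dom i q.1];
     coord := fun i q => row_mx (coord i q.1) (q.2)%:M;
     param := fun i x => (param i (lsubmx x), rsubmx x 0 0) |}.

Definition cyl_metric (R : realType) n (M : Type) (A : atlas R n M)
    (g : metric A) : metric (cyl_atlas A) :=
  fun i x => block_mx (g i (lsubmx x)) 0 0 1%:M.

Definition height (R : realType) (M : Type) (q : M * R) : R := q.2.

Definition slice (R : realType) (M : Type) (a : R) : set (M * R) :=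
  [set q | q.2 = a].

(** ** Connection and gradient in a chart *)

Definition christoffel (R : realType) n (G : 'rV[R]_n -> 'M[R]_n)
    (x : 'rV[R]_n) (a b c : 'I_n) : R :=
  \sum_(e < n) 2^-1 * invmx (G x) a e *
    (partial G x b e c + partial G x c e b - partial G x e b c).

Definition grad (R : realType) n (M : Type) (A : atlas R n M) (g : metric A)
    (f : M -> R) (i : chart A) (x : 'rV[R]_n) : 'rV[R]_n :=
  (\row_a partial (f \o param i) x a) *m invmx (g i x).

(** ** Immersed hypersurfaces *)

Definition loc (R : realType) n m (S X : Type) (AS : atlas R n S)
    (AX : atlas R m X) (iota : S -> X) (c : chart AS) (i : chart AX)
    (x : 'rV[R]_n) : 'rV[R]_m :=
  coord i (iota (param c x)).

Definition loc_dom (R : realType) n m (S X : Type) (AS : atlas R n S)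
    (AX : atlas R m X) (iota : S -> X) (c : chart AS) (i : chart AX) :
    set 'rV[R]_n :=
  coord c @` (dom c `&` iota @^-1` dom i).

Definition is_immersion (R : realType) n m (S X : topologicalType)
    (AS : atlas R n S) (AX : atlas R m X) (iota : S -> X) : Prop :=
  continuous iota /\
  forall (c : chart AS) (i : chart AX),
    smooth_on (loc_dom iota c i) (loc iota c i) /\
    forall x, loc_dom iota c i x -> row_free (jac (loc iota c i) x).

(** A vector field [N] along [iota] is given by its coordinates [N i s] in the
    frame of the chart [i] at [iota s]; the first clause is the
    change-of-chart rule. *)
Definition is_unit_normal (R : realType) n m (S X : Type)
    (AS : atlas R n S) (AX : atlas R m X) (g : metric AX) (iota : S -> X)
    (N : chart AX -> S -> 'rV[R]_m) : Prop :=
  [/\ forall i j s, dom i (iota s) -> dom j (iota s) ->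
        N j s = N i s *m jac (trans i j) (coord i (iota s)),
      forall (c : chart AS) i,
        smooth_on (loc_dom iota c i) (N i \o param c),
      forall i s, dom i (iota s) ->
        inner (g i (coord i (iota s))) (N i s) (N i s) = 1 &
      forall (c : chart AS) i s, dom c s -> dom i (iota s) ->
        forall k, inner (g i (coord i (iota s)))
          (row k (jac (loc iota c i) (coord c s))) (N i s) = 0].

(** Covariant derivative along [iota], in the direction of the k-th coordinate
    vector of the chart [c], of the vector field [N] along [iota]. *)
Definition cov (R : realType) n m (S X : Type) (AS : atlas R n S)
    (AX : atlas R m X) (g : metric AX) (iota : S -> X)
    (N : chart AX -> S -> 'rV[R]_m) (c : chart AS) (i : chart AX)
    (x : 'rV[R]_n) (k : 'I_n) : 'rV[R]_m :=
  let J := jac (loc iota c i) x in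
  \row_a (partial (N i \o param c) x k 0 a +
          \sum_(b < m) \sum_(d < m)
            christoffel (g i) (loc iota c i x) a b d
            * J k b * N i (param c x) 0 d).

(** Trace over the tangent space of [X |-> <D_X N, X>], computed with the
    inverse of the induced metric [J G J^T]. *)
Definition div_tangent (R : realType) n m (S X : Type) (AS : atlas R n S)
    (AX : atlas R m X) (g : metric AX) (iota : S -> X)
    (N : chart AX -> S -> 'rV[R]_m) (c : chart AS) (i : chart AX)
    (x : 'rV[R]_n) : R :=
  let J := jac (loc iota c i) x in
  let G := g i (loc iota c i x) in
  \sum_(k < n) \sum_(l < n)
    invmx (J *m G *m J^T) k l * inner G (cov g iota N c i x k) (row l J).

Definition weighted_mean_curvature (R : realType) n m (S X : Type)
    (AS : atlas R n S) (AX : atlas R m X) (g : metric AX) (psi : X -> R)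
    (iota : S -> X) (N : chart AX -> S -> 'rV[R]_m) (c : chart AS)
    (i : chart AX) (s : S) : R :=
  - div_tangent g iota N c i (coord c s)
  - inner (g i (coord i (iota s))) (grad g psi i (coord i (iota s))) (N i s).

(** The weighted mean curvature does not depend on the charts [c] and [i] in
    which it is computed. *)
Definition weighted_minimal (R : realType) n m (S X : Type)
    (AS : atlas R n S) (AX : atlas R m X) (g : metric AX) (psi : X -> R)
    (iota : S -> X) (N : chart AX -> S -> 'rV[R]_m) : Prop :=
  forall (c : chart AS) (i : chart AX) s, dom c s -> dom i (iota s) ->
    weighted_mean_curvature g psi iota N c i s = 0.

(* Main.v *)
Require Import Defs.
From HB Require Import structures.
From mathcomp Require Import all_boot all_order all_algebra.
From mathcomp Require Import all_classical all_reals all_analysis.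
From mathcomp Require Import ring lra.

Set Implicit Arguments.
Unset Strict Implicit.
Unset Printing Implicit Defensive.

Import Order.TTheory GRing.Theory Num.Theory.
Import numFieldNormedType.Exports.

Local Open Scope classical_set_scope.
Local Open Scope ring_scope.

(** The height function [u] of the hypersurface satisfies, in every interior
    chart, a linear elliptic equation [L u = v'(u)], where [L] has no term of
    order zero: because the vertical field is parallel, [L] is the weighted
    Laplacian of the hypersurface, of whose first order coefficients only the
    continuity matters. In case (i), [u] is thus a
    supersolution with values at most [a], equal to [a] on the boundary. If its
    minimum were less than [a], the set where it is attained would avoid the
    boundary, would be open by the strong minimum principle, and would be closed,
    hence would be the whole connected hypersurface, boundary included. So [u] is
    constantly [a], and the equation then reads [v'(a) = 0]. Case (ii) is the same
    with [- u].

    The ambient manifold may have a boundary, which the hypersurface may touch at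
    interior points; this is harmless because only one-sided partial derivatives
    of the ambient data enter, and they are those of smooth extensions. *)

(** * Calculus of maps of class C^k *)

Section Calculus.
Variable R : realType.

(** Minimality controls only the normal component of the trace of the second derivatives of the
    immersion, so the equation for [u] comes from splitting the vertical vector into a tangential
    and a normal part. That trace minus the differential of the weight annihilates [N]; paired with
    the vertical vector, it sees only the tangential part, whose coordinates are the first
    derivatives of [u]. The remainder is thus of first order, and it goes into the drift without
    being identified further. The obstacle is regularity: [Ck] speaks of directional derivatives,
    and the ambient metric and weight are known only on a relatively open part of a half-space.
    Hence differentiability and a chain rule are established for C^1 functions, and one-sided
    partial derivatives are computed on local smooth extensions. The equation is available at
    interior points only, so [v'(a)] is read at a point obtained by pushing a boundary point
    inwards. *)

Lemma is_derive_line (V W : normedModType R) (f : V -> W) (x v : V) (t : R) :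
  derivable f (t *: v + x) v ->
  is_derive t 1 (fun s : R => f (s *: v + x)) ('D_v f (t *: v + x)).
Proof.
move=> df.
have E : (fun h : R => h^-1 *: (((fun s : R => f (s *: v + x)) \o shift t) (h *: 1)
            - f (t *: v + x))) =
         (fun h => h^-1 *: ((f \o shift (t *: v + x)) (h *: v) - f (t *: v + x))).
  by apply/funext => h /=; rewrite [h%:A]mulr1 scalerDl addrA.
by split; rewrite /derivable /derive E.
Qed.

Lemma derivableZv (V W : normedModType R) (f : V -> W) (x v : V) (c : R) :
  derivable f x v -> is_derive x (c *: v) f (c *: 'D_v f x).
Proof.
move=> df.
have [->|c0] := eqVneq c 0.
  by rewrite !scale0r; apply: is_derive0.
have h0 : derivable f (0 *: v + x) v by rewrite scale0r add0r.
have := is_derive_line h0; rewrite scale0r add0r => -[d1 e1].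
have dl : differentiable (fun s : R => f (s *: v + x)) 0 by apply/derivable1_diffP.
have dm : is_diff (0:R) ( *:%R^~ c : R -> R) ( *:%R^~ c) by apply: is_diff_scalel.
have dc : differentiable ((fun s : R => f (s *: v + x)) \o ( *:%R^~ c : R -> R)) 0.
  by apply: differentiable_comp => //; rewrite scale0r.
have E : (fun h : R => f (h *: (c *: v) + x)) =
    (fun s : R => f (s *: v + x)) \o ( *:%R^~ c : R -> R).
  by apply/funext => h /=; rewrite scalerA.
have dD : derivable f x (c *: v).
  by apply/derivable1P; rewrite E; apply/derivable1_diffP.
split => //.
have h1 : derivable f (0 *: (c *: v) + x) (c *: v) by rewrite scale0r add0r.
have := is_derive_line h1; rewrite scale0r add0r E => -[_ <-].
rewrite deriveE // diff_comp //; last by rewrite scale0r.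
rewrite /= scale0r diff_val /= -e1 deriveE // -linearZ /=.
by rewrite [1 *: c]mul1r [c *: 1]mulr1.
Qed.

Lemma Ck_cont (V W : normedModType R) k (U : set V) (f : V -> W) x :
  Ck k U f -> U x -> {for x, continuous f}.
Proof. by case: k => [|k] [+ _]; apply. Qed.

Lemma Ck_derivable (V W : normedModType R) k (U : set V) (f : V -> W) x v :
  Ck k.+1 U f -> U x -> derivable f x v.
Proof. by move=> [_ /(_ v)[+ _]]; apply. Qed.

Lemma Ck_derive (V W : normedModType R) k (U : set V) (f : V -> W) v :
  Ck k.+1 U f -> Ck k U ('D_v f).
Proof. by move=> [_ /(_ v)[]]. Qed.

Lemma near_line (V : normedModType R) (U : set V) (x v : V) :
  nbhs x U -> \forall t \near (0 : R), U (t *: v + x).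
Proof.
move=> Ux.
have : (t *: v + x) @[t --> (0:R)] --> x.
  rewrite -[X in _ --> X]add0r -[X in _ --> X + _](scale0r v).
  apply: cvgD; last exact: cvg_cst.
  by apply: cvgZr_tmp; exact: cvg_id.
by apply.
Qed.

(* The mean value theorem in the direction [v] turns the second increment of
   f (x + t u + t v) - f x into a value of ['D_v f] near [x]. *)
Lemma Ck_deriveD (V : normedModType R) (U : set V) (f : V -> R) (x u v : V) :
  open U -> Ck 1 U f -> U x -> 'D_(u + v) f x = 'D_u f x + 'D_v f x.
Proof.
move=> oU Cf Ux.
apply: cvg_lim => //; apply/cvgrPdist_le => e e0.
have du : derivable f x u by apply: Ck_derivable Cf Ux.
have e20 : 0 < e / 2 by rewrite divr_gt0.
have /cvgrPdist_le/(_ _ e20) hu := du.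
have cv : {for x, continuous ('D_v f)} by apply: Ck_cont (Ck_derive _ Cf) Ux.
have /cvgrPdist_le/(_ _ e20) hv : 'D_v f y @[y --> x] --> 'D_v f x by exact: cv.
have Unb : nbhs x (U `&` [set y | `|'D_v f x - 'D_v f y| <= e / 2]).
  by apply: filterI => //; exact: open_nbhs_nbhs.
have /nbhs_ballP[d /= d0 hd] := Unb.
(* This bound on [|h|] keeps [h u + s v] shorter than [d] for all [|s| <= |h|]; the added 1 makes
   the denominator positive. *)
have dv0 : 0 < d / (1 + `|u| + `|v|).
  by rewrite divr_gt0 // -addrA ltr_pwDl // addr_ge0.
near=> h.
have hn0 : h != 0 by near: h; exact: nbhs_dnbhs_neq.
have hsmall : `|h| < d / (1 + `|u| + `|v|) by near: h; exact: dnbhs0_lt.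
have hin (s : R) : `|s| <= `|h| -> ball x d (s *: v + (h *: u + x)).
  move=> sh; rewrite -ball_normE /ball_ /= addrA opprD addrCA subrr addr0 normrN.
  apply: (le_lt_trans (ler_normD _ _)); rewrite !normrZ.
  rewrite (le_lt_trans (y := `|h| * (1 + `|u| + `|v|))) //.
    rewrite !mulrDr mulr1 addrC lerD ?ler_wpM2r //.
    by rewrite lerDr.
  by rewrite -ltr_pdivlMr // -addrA ltr_pwDl // addr_ge0.
have der (s : R) : `|s| <= `|h| ->
    is_derive s 1 (fun s : R => f (s *: v + (h *: u + x))) ('D_v f (s *: v + (h *: u + x))).
  by move=> sh; apply: is_derive_line; apply: Ck_derivable Cf _; case: (hd _ (hin _ sh)).
have dif (s : R) : `|s| <= `|h| -> differentiable (fun s : R => f (s *: v + (h *: u + x))) s.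
  by move=> sh; apply/derivable1_diffP; case: (der _ sh).
have con (a b : R) : (forall s, s \in `[a, b]%R -> `|s| <= `|h|) ->
    {within `[a, b], continuous (fun s : R => f (s *: v + (h *: u + x)))}.
  move=> hs; apply: derivable_within_continuous => s /hs /der[] //.
have [c ch Ec] : exists2 c, `|c| <= `|h| &
    f (h *: v + (h *: u + x)) - f (h *: u + x) = h * 'D_v f (c *: v + (h *: u + x)).
  have [hp|hp] := ltP 0 h.
    have sb s : s \in `[0, h]%R -> `|s| <= `|h|.
      by rewrite in_itv /= => /andP[s0 sh]; rewrite !ger0_norm // ltW.
    have [||c cI] := @MVT _ (fun s : R => f (s *: v + (h *: u + x)))
      (fun s => 'D_v f (s *: v + (h *: u + x))) 0 h hp.
    - move=> s sI; apply: der; apply: sb.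
      by move: sI; rewrite !in_itv /= => /andP[/ltW -> /ltW ->].
    - exact: con.
    rewrite scale0r add0r subr0 => E; exists c; last by rewrite E mulrC.
    by apply: sb; move: cI; rewrite !in_itv /= => /andP[/ltW -> /ltW ->].
  have {}hp : h < 0 by rewrite lt_neqAle hn0.
  have sb s : s \in `[h, 0]%R -> `|s| <= `|h|.
    by rewrite in_itv /= => /andP[s0 sh]; rewrite !ler0_norm ?lerN2 // ltW.
  have [||c cI] := @MVT _ (fun s : R => f (s *: v + (h *: u + x)))
      (fun s => 'D_v f (s *: v + (h *: u + x))) h 0 hp.
  - move=> s sI; apply: der; apply: sb.
    by move: sI; rewrite !in_itv /= => /andP[/ltW -> /ltW ->].
  - exact: con.
  rewrite scale0r add0r sub0r mulrN => E; exists c.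
    by apply: sb; move: cI; rewrite !in_itv /= => /andP[/ltW -> /ltW ->].
  by rewrite -opprB E opprK mulrC.
have -> : h^-1 *: ((f \o shift x) (h *: (u + v)) - f x) =
    h^-1 *: ((f \o shift x) (h *: u) - f x) + 'D_v f (c *: v + (h *: u + x)).
  have -> : (f \o shift x) (h *: (u + v)) - f x =
     ((f \o shift x) (h *: u) - f x) + h * 'D_v f (c *: v + (h *: u + x)).
    by rewrite -Ec /= scalerDr (addrC (h *: u)) -addrA addrC [RHS]addrC subrKA addrC.
  by rewrite scalerDr; congr (_ + _); rewrite [_ *: _]mulrA mulVf // mul1r.
rewrite opprD addrACA (le_trans (ler_normD _ _)) // [leRHS]splitr lerD //.
  by near: h.
by have [_] := hd _ (hin c ch).
Unshelve. all: by end_near. Qed.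

End Calculus.

(** * Differentiability of C^1 functions, and stability properties of the class C^k *)

Section Smoothness.
Variable R : realType.

Lemma Ck_derive_sum (V : normedModType R) (U : set V) (f : V -> R) (x : V)
    (I : Type) (r : seq I) (v : I -> V) :
  open U -> Ck 1 U f -> U x ->
  'D_(\sum_(i <- r) v i) f x = \sum_(i <- r) 'D_(v i) f x.
Proof.
move=> oU Cf Ux; elim: r => [|i r IH]; first by rewrite !big_nil derive0.
by rewrite !big_cons (Ck_deriveD _ _ oU Cf Ux) IH.
Qed.

Lemma Ck_derive_row n (U : set 'rV[R]_n) (f : 'rV[R]_n -> R) (x h : 'rV[R]_n) :
  open U -> Ck 1 U f -> U x ->
  'D_h f x = \sum_k h 0 k * 'D_(delta_mx 0 k) f x.
Proof.
move=> oU Cf Ux; rewrite {1}(row_sum_delta h) (Ck_derive_sum _ _ oU Cf Ux).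
apply: eq_bigr => k _; have := Ck_derivable (v := delta_mx 0 k) Cf Ux.
by move=> /(derivableZv (h 0 k))[_ ->].
Qed.

Lemma MVT_line (V : normedModType R) (f : V -> R) (x h : V) :
  (forall t : R, 0 <= t <= 1 -> derivable f (t *: h + x) h) ->
  exists2 t : R, 0 < t < 1 & f (h + x) - f x = 'D_h f (t *: h + x).
Proof.
move=> df.
have [|||c cI] := @MVT _ (fun s : R => f (s *: h + x))
   (fun s => 'D_h f (s *: h + x)) 0 1.
- exact: ltr01.
- move=> s; rewrite in_itv /= => /andP[s0 s1].
  by apply: is_derive_line; apply: df; rewrite !ltW.
- apply: derivable_within_continuous => s; rewrite in_itv /= => sI.
  by have [] := is_derive_line (df s sI).
rewrite scale0r add0r scale1r subr0 mulr1 => ->.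
by exists c => //; move: cI; rewrite in_itv.
Qed.

Lemma rV_entry_norm n (h : 'rV[R]_n) k : `|h 0 k| <= `|h|.
Proof.
rewrite [leRHS]/Num.Def.normr /= mx_normrE.
exact: (le_bigmax _ (fun i : 'I_1 * 'I_n => `|h i.1 i.2|) (0, k)).
Qed.

Lemma differentiable_bound (V W : normedModType R) (f : V -> W)
    (L : {linear V -> W}) (x : V) :
  continuous L ->
  (forall e : R, 0 < e ->
    \forall h \near (0 : V), `|f (h + x) - f x - L h| <= e * `|h|) ->
  differentiable f x.
Proof.
move=> cL H.
suff E : f \o shift x = cst (f x) + L +o_ 0 id.
  by apply/diff_locallyP; rewrite (diff_unique cL E).
apply/eqaddoP => e e0; apply: filterS (H e e0) => h.
by rewrite -addrA -opprD.
Qed.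

(** The increment along [h] is a directional derivative at an intermediate point of the segment.
    Expanding it in partial derivatives there, as at [x], leaves an error governed by the continuity
    of the partial derivatives. *)
Lemma Ck_differentiable n (U : set 'rV[R]_n) (f : 'rV[R]_n -> R)
    (x : 'rV[R]_n) :
  open U -> Ck 1 U f -> U x -> differentiable f x.
Proof.
move=> oU Cf Ux.
pose C : 'cV[R]_n := \col_k 'D_(delta_mx 0 k) f x.
pose L := (fun h : 'rV[R]_n => (h *m C) 0 0).
have Llin : linear (L : 'rV[R]_n -> R).
  by move=> c u v; rewrite /L mulmxDl -scalemxAl !mxE.
pose lL : {linear 'rV[R]_n -> R} :=
  HB.pack (L : 'rV[R]_n -> R) (GRing.isLinear.Build _ _ _ _ _ Llin).
have LE h : lL h = \sum_k h 0 k * 'D_(delta_mx 0 k) f x.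
  by rewrite /= /L mxE; apply: eq_bigr => k _; rewrite !mxE.
have Lc : continuous lL.
  have -> : (lL : 'rV[R]_n -> R) = \sum_k (fun h => h 0 k * 'D_(delta_mx 0 k) f x).
    by apply/funext => h; rewrite fct_sumE LE.
  elim/big_ind: _ => [|g1 g2 c1 c2 y|k _ y].
  - by move=> y; exact: cst_continuous.
  - by apply: (@cvgD _ _ _ (nbhs y)); [exact: (c1 y)|exact: (c2 y)].
  - by apply: (@cvgM _ _ (nbhs y) _ _ _ (y 0 k)); [exact: coord_continuous|exact: cvg_cst].
apply: (differentiable_bound Lc) => e e0.
(* The [n] coordinates share the error [e]; the added 1 keeps the denominator positive when [n] is
   0. *)
have n0 : 0 < e / (n%:R + 1) by rewrite divr_gt0 // ltr_wpDl.
have Unb : nbhs x (U `&` [set y | forall k : 'I_n,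
    `|'D_(delta_mx 0 k) f x - 'D_(delta_mx 0 k) f y| <= e / (n%:R + 1)]).
  apply: filterI; first exact: open_nbhs_nbhs.
  apply: (@filter_forall _ _ (fun (k : 'I_n) => [set y | `|'D_(delta_mx 0 k) f x
    - 'D_(delta_mx 0 k) f y| <= e / (n%:R + 1)]) (nbhs x) _) => k.
  have cv : {for x, continuous ('D_(delta_mx 0 k) f)}.
    by apply: Ck_cont (Ck_derive _ Cf) Ux.
  by have /cvgrPdist_le/(_ _ n0) := cv.
have /nbhs_ballP[d /= d0 hd] := Unb.
near=> h.
have hd1 : `|h| < d by near: h; exact: (@nbhs0_lt R ('rV[R]_n) d d0).
have inb (t : R) : 0 <= t <= 1 -> ball x d (t *: h + x).
  move=> /andP[t0 t1]; rewrite -ball_normE /ball_ /= opprD addrCA subrr addr0.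
  rewrite normrN normrZ ger0_norm //; apply: le_lt_trans hd1.
  by rewrite ler_piMl.
have [t tI E] : exists2 t : R, 0 < t < 1 & f (h + x) - f x = 'D_h f (t *: h + x).
  apply: MVT_line => t tI; apply: Ck_derivable Cf _.
  by case: (hd _ (inb _ tI)).
have [Ut Dt] : (U `&` [set y | forall k : 'I_n,
    `|'D_(delta_mx 0 k) f x - 'D_(delta_mx 0 k) f y| <= e / (n%:R + 1)]) (t *: h + x).
  by apply: hd; apply: inb; case/andP: tI => /ltW -> /ltW ->.
rewrite E.
rewrite (Ck_derive_row _ oU Cf Ut) (LE h : L h = _) -sumrB.
apply: (le_trans (ler_norm_sum _ _ _)).
apply: (@le_trans _ _ (\sum_(k < n) `|h| * (e / (n%:R + 1)))).
  apply: ler_sum => k _; rewrite -mulrBr normrM ler_pM ?rV_entry_norm //.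
  by rewrite distrC.
rewrite sumr_const card_ord -[leLHS]mulr_natr.
have -> : `|h| * (e / (n%:R + 1)) * n%:R = (e * `|h|) * (n%:R / (n%:R + 1)).
  by rewrite -!mulrA mulrCA; congr (_ * (_ * _)); rewrite mulrC.
rewrite ler_piMr ?mulr_ge0 // ?(ltW e0) //.
by rewrite ler_pdivrMr ?mul1r ?lerDl ?ltr_wpDl.
Unshelve. all: by end_near. Qed.

Lemma chain_rule (X V : normedModType R) (f : V -> R) (F : X -> V) (x v : X) :
  differentiable f (F x) -> derivable F x v ->
  is_derive x v (f \o F) ('D_('D_v F x) f (F x)).
Proof.
move=> df dF.
have h0 : derivable F (0 *: v + x) v by rewrite scale0r add0r.
have := is_derive_line h0; rewrite scale0r add0r => -[d1 e1].
have dl : differentiable (fun s : R => F (s *: v + x)) 0 by apply/derivable1_diffP.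
have dc : differentiable (f \o (fun s : R => F (s *: v + x))) 0.
  by apply: differentiable_comp => //; rewrite scale0r add0r.
have dD : derivable (f \o F) x v by apply/derivable1P/derivable1_diffP.
split => //.
have h1 : derivable (f \o F) (0 *: v + x) v by rewrite scale0r add0r.
have := is_derive_line h1; rewrite scale0r add0r => -[_ <-].
rewrite deriveE // [LHS](_ : _ = 'd (f \o (fun s : R => F (s *: v + x))) 0 1) //.
rewrite diff_comp //; last by rewrite scale0r add0r.
by rewrite /= scale0r add0r deriveE // -e1 deriveE.
Qed.

Lemma near_eq_continuous (V W : topologicalType) (f g : V -> W) x :
  {near x, f =1 g} -> {for x, continuous f} -> {for x, continuous g}.
Proof.
move=> E cf; have Ex := nbhs_singleton E.
rewrite /prop_for /continuous_at -Ex; apply: cvg_trans cf.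
by apply: near_eq_cvg; apply: filterS E => y ->.
Qed.

Lemma Ck_subset (V W : normedModType R) k (B U : set V) (f : V -> W) :
  B `<=` U -> Ck k U f -> Ck k B f.
Proof.
move=> BU; elim: k f => [|k IH] f [c1 c2].
  by split=> // x /BU; exact: c1.
split=> [x /BU|v]; first exact: c1.
by have [d1 d2] := c2 v; split=> [x /BU|]; [exact: d1|exact: IH].
Qed.

(** [Ck k.+1] bears on the function ['D_v f] itself, whereas formulas for it usually hold on [U]
    only; locality allows such a formula to be put in its place. The induction works because
    functions that agree near a point have the same derivatives there. *)
Lemma Ck_local (V W : normedModType R) k (U : set V) (f : V -> W) :
  (forall x, U x -> exists (B : set V) (fe : V -> W),
     [/\ open B, B x, Ck k B fe & forall y, B y -> U y -> f y = fe y]) ->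
  open U -> Ck k U f.
Proof.
elim: k U f => [|k IH] U f H oU.
  split=> // x Ux; have [B [fe [oB Bx Cfe E]]] := H x Ux.
  have Ex : {near x, f =1 fe}.
    near=> y; apply: E; near: y; exact: open_nbhs_nbhs.
  by apply: near_eq_continuous (Ck_cont Cfe Bx); apply: filterS Ex => y ->.
have loc x : U x -> exists (B : set V) (fe : V -> W),
   [/\ open B, B x, B `<=` U, Ck k.+1 B fe & forall y, B y -> {near y, f =1 fe}].
  move=> Ux; have [B [fe [oB Bx Cfe E]]] := H x Ux.
  exists (B `&` U), fe; split=> //.
  - exact: openI.
  - exact: (@Ck_subset _ _ k.+1 _ B fe (@subIsetl _ B U) Cfe).
  - move=> y [By Uy]; near=> z; apply: E; near: z; exact: open_nbhs_nbhs.
split=> [x /loc[B [fe [oB Bx BU Cfe E]]]|v].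
  have Ex := E x Bx.
  by apply: near_eq_continuous (Ck_cont Cfe Bx); apply: filterS Ex => y ->.
split=> [x /loc[B [fe [oB Bx BU Cfe E]]]|].
  apply: near_eq_derivable (Ck_derivable (v := v) Cfe Bx).
  by apply: filterS (E x Bx) => y ->.
apply: IH => // x /loc[B [fe [oB Bx BU Cfe E]]].
exists B, ('D_v fe); split=> //; first exact: Ck_derive.
by move=> y By _; apply: near_eq_derive; apply: filterS (E y By) => z ->.
Unshelve. all: by end_near. Qed.

Lemma CkW (V W : normedModType R) k (U : set V) (f : V -> W) :
  Ck k.+1 U f -> Ck k U f.
Proof.
elim: k f => [|k IH] f [c1 c2]; split=> // v.
by have [d1 d2] := c2 v; split=> //; exact: IH.
Qed.

Lemma CkD (V W : normedModType R) k (U : set V) (f g : V -> W) :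
  open U -> Ck k U f -> Ck k U g -> Ck k U (fun x => f x + g x).
Proof.
move=> oU; elim: k f g => [|k IH] f g Cf Cg.
  by split=> // x Ux; exact: (continuousD (Ck_cont Cf Ux) (Ck_cont Cg Ux)).
split=> [x Ux|v].
  by exact: (continuousD (Ck_cont Cf Ux) (Ck_cont Cg Ux)).
have E x : U x -> 'D_v (fun x => f x + g x) x = 'D_v f x + 'D_v g x.
  by move=> Ux; apply: deriveD; [exact: Ck_derivable Cf Ux|exact: Ck_derivable Cg Ux].
split=> [x Ux|].
  by apply: derivableD; [exact: Ck_derivable Cf Ux|exact: Ck_derivable Cg Ux].
apply: Ck_local => // x Ux.
exists U, (fun x => 'D_v f x + 'D_v g x); split=> //.
  by apply: IH; apply: Ck_derive.
by move=> y Uy _; exact: E.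
Qed.

Lemma CkZ (V W : normedModType R) k (U : set V) (f : V -> W) (c : R) :
  open U -> Ck k U f -> Ck k U (fun x => c *: f x).
Proof.
move=> oU; elim: k f => [|k IH] f Cf.
  by split=> // x Ux; exact: (continuousZl_tmp (k := c) (Ck_cont Cf Ux)).
split=> [x Ux|v]; first by exact: (continuousZl_tmp (k := c) (Ck_cont Cf Ux)).
have E x : U x -> 'D_v (fun x => c *: f x) x = c *: 'D_v f x.
  by move=> Ux; apply: deriveZ; exact: Ck_derivable Cf Ux.
split=> [x Ux|]; first by apply: derivableZ; exact: Ck_derivable Cf Ux.
apply: Ck_local => // x Ux.
exists U, (fun x => c *: 'D_v f x); split=> //.
  by apply: IH; apply: Ck_derive.
by move=> y Uy _; exact: E.
Qed.

Lemma Ck_cst (V W : normedModType R) k (U : set V) (c : W) :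
  Ck k U (fun _ : V => c).
Proof.
elim: k c => [|k IH] c; split=> //; try by move=> x _; exact: cvg_cst.
move=> v; split=> [x _|]; first exact: derivable_cst.
by rewrite [X in Ck _ _ X](_ : _ = fun=> 0) //; apply/funext => x; rewrite derive_cst.
Qed.

(** The difference quotients of [f \o L] along [v] are those of [f] along [L v]. *)
Lemma Ck_comp_linear (V V' W : normedModType R) k (U : set V') (f : V' -> W)
    (L : {linear V -> V'}) :
  continuous L -> Ck k U f -> Ck k (L @^-1` U) (f \o L).
Proof.
move=> cL.
have E (g : V' -> W) x v : (fun h : R => h^-1 *: (((g \o L) \o shift x) (h *: v) - (g \o L) x)) =
    (fun h : R => h^-1 *: ((g \o shift (L x)) (h *: L v) - g (L x))).
  by apply/funext => h /=; rewrite linearP.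
elim: k f => [|k IH] f [c1 c2].
  by split=> // x /= Ux; apply: continuous_comp; [exact: cL|exact: c1].
split=> [x /= Ux|v]; first by apply: continuous_comp; [exact: cL|exact: c1].
have [d1 d2] := c2 (L v).
split=> [x Ux|]; first by rewrite /derivable E; exact: d1.
rewrite [X in Ck _ _ X](_ : _ = 'D_(L v) f \o L); first exact: IH.
by apply/funext => x; rewrite /derive E.
Qed.

Lemma Ck_mx (V : normedModType R) k (U : set V) m n (f : V -> 'M[R]_(m, n)) :
  open U -> (forall i j, Ck k U (fun x => f x i j)) -> Ck k U f.
Proof.
move=> oU.
have cont (g : V -> 'M[R]_(m, n)) x :
    (forall i j, {for x, continuous (fun x => g x i j)}) -> {for x, continuous g}.
  move=> H; apply/cvgrPdist_le => e e0; near=> y.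
  rewrite /Num.Def.normr /= mx_normrE (bigmax_le _ (ltW e0)) //= => -[i j] _.
  rewrite !mxE /=; move: i j.
  suff : forall ij : 'I_m * 'I_n, `|g x ij.1 ij.2 - g y ij.1 ij.2| <= e.
    by move=> H' i j; exact: (H' (i, j)).
  near: y; apply: filter_forall => ij.
  by have /cvgrPdist_le/(_ _ e0) := H ij.1 ij.2.
elim: k f => [|k IH] f Cf; split=> //;
  try by move=> x Ux; apply: cont => i j; exact: Ck_cont (Cf i j) Ux.
move=> v; have df x : U x -> derivable f x v.
  by move=> Ux; apply/derivable_mxP => i j; exact: Ck_derivable (Cf i j) Ux.
split=> //; apply: IH => i j.
apply: Ck_local => // x Ux; exists U, ('D_v (fun x => f x i j)); split=> //.
  exact: Ck_derive (Cf i j).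
by move=> y Uy _; rewrite derive_mx ?mxE //; exact: df.
Unshelve. all: by end_near. Qed.

Lemma Ck_entry (V : normedModType R) k (U : set V) m n (f : V -> 'M[R]_(m, n)) i j :
  open U -> Ck k U f -> Ck k U (fun x => f x i j).
Proof.
move=> oU.
have cont (g : V -> 'M[R]_(m, n)) x : {for x, continuous g} -> {for x, continuous (fun x => g x i j)}.
  move=> cg; apply: (continuous_comp (f := g) (g := fun M : 'M[R]_(m, n) => M i j)) => //.
  exact: coord_continuous.
elim: k f => [|k IH] f Cf; split=> //; try by move=> x Ux; apply: cont; exact: Ck_cont Cf Ux.
move=> v; split=> [x Ux|].
  by have /derivable_mxP := Ck_derivable (v := v) Cf Ux; apply.
apply: Ck_local => // x Ux; exists U, (fun y => 'D_v f y i j); split=> //.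
  by apply: IH; exact: Ck_derive.
by move=> y Uy _; rewrite derive_mx ?mxE //; exact: Ck_derivable Cf Uy.
Qed.

End Smoothness.

(** * Positive definite matrices *)

Section LinearAlgebra.
Variable R : realType.

Definition posdef n (P : 'M[R]_n) :=
  forall u : 'rV[R]_n, u != 0 -> 0 < (u *m P *m u^T) 0 0.

Lemma bilinear_formE n (X Y : 'rV[R]_n) (Q : 'M[R]_n) :
  (X *m Q *m Y^T) 0 0 = \sum_k \sum_l X 0 k * Q k l * Y 0 l.
Proof.
rewrite mxE.
under eq_bigr => l _ do rewrite !mxE mulr_suml.
by rewrite exchange_big.
Qed.

Lemma posdef_unit n (P : 'M[R]_n) : posdef P -> P \in unitmx.
Proof.
move=> pP; rewrite -row_free_unit -kermx_eq0; apply/negP => /negP /rowV0Pn.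
move=> [u /sub_kermxP uP u0]; have := pP u u0.
by rewrite uP mul0mx mxE ltxx.
Qed.

(** Elimination of the first coordinate: the Schur complement [D - al^-1 b^T b] is again symmetric
    and positive definite, and a factor of it is completed by a first column. *)
Lemma cholesky n (P : 'M[R]_n) : P^T = P -> posdef P ->
  exists L : 'M[R]_n, P = L *m L^T.
Proof.
elim: n P => [|n IH] P sP pP; first by exists 0; apply/matrixP => -[].
pose P' : 'M[R]_(1 + n) := P.
pose al := P' 0 0; pose b := ursubmx P'; pose D := drsubmx P'.
have sP' : P'^T = P' by [].
have E : P' = block_mx al%:M b b^T D.
  rewrite -[LHS]submxK; congr (block_mx _ _ _ _).
    by rewrite [LHS]mx11_scalar !mxE; congr (P' _ _)%:M; apply: val_inj.
  by apply/matrixP => i j; rewrite !mxE -[in LHS]sP' mxE.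
have sD : D^T = D by apply/matrixP => i j; rewrite !mxE -[in LHS]sP' mxE.
have addE (X Y : 'M[R]_1) : (X + Y) 0 0 = X 0 0 + Y 0 0 by rewrite mxE.
have quad (s : R) (u : 'rV[R]_n) : (row_mx s%:M u *m P' *m (row_mx s%:M u)^T) 0 0 =
    al * s ^+ 2 + 2 * s * (u *m b^T) 0 0 + (u *m D *m u^T) 0 0.
  rewrite E mul_row_block tr_row_mx mul_row_col !mulmxDl !addE.
  have E1 : (s%:M *m al%:M *m (s%:M : 'M[R]_1)^T) 0 0 = al * s ^+ 2.
    by rewrite tr_scalar_mx -!scalar_mxM mxE /= mulr1n expr2 mulrCA mulrA.
  have E2 : (u *m b^T *m (s%:M : 'M[R]_1)^T) 0 0 = s * (u *m b^T) 0 0.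
    by rewrite tr_scalar_mx mul_mx_scalar mxE.
  have E3 : (s%:M *m b *m u^T) 0 0 = s * (u *m b^T) 0 0.
    rewrite mul_scalar_mx -scalemxAl mxE; congr (_ * _).
    have -> : b *m u^T = (u *m b^T)^T by rewrite trmx_mul trmxK.
    by rewrite mxE.
  by rewrite E1 E2 E3 -mulrA mulr_natl mulr2n !addrA.
have al0 : 0 < al.
  have H : (row_mx 1%:M 0 : 'rV[R]_(1 + n)) != 0 -> 0 < al.
    move=> /pP; rewrite [X in 0 < X -> _](quad 1 0) !mul0mx !mxE mulr0 !addr0.
    by rewrite expr1n mulr1.
  apply: H.
  apply/eqP => /(congr1 (@lsubmx R 1 1 n)); rewrite row_mxKl => /rowP /(_ 0).
  by rewrite !mxE => /eqP; rewrite oner_eq0.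
have [||L' EL] := IH (D - al^-1 *: (b^T *m b)).
- by rewrite linearB linearZ /= trmx_mul trmxK sD.
- move=> u u0.
  (* For a given [u], this first coordinate minimizes the quadratic form of [P]; the minimum is the
     value of the Schur complement at [u]. *)
  have := @pP (row_mx (- al^-1 * (u *m b^T) 0 0)%:M u : 'rV[R]_(1 + n)).
  rewrite [X in (_ -> 0 < X) -> _](quad _ u).
  set x := (u *m b^T) 0 0.
  have -> : (u *m (D - al^-1 *: (b^T *m b)) *m u^T) 0 0 = (u *m D *m u^T) 0 0 - al^-1 * x ^+ 2.
    rewrite mulmxBr mulmxBl -scalemxAr -scalemxAl [LHS]mxE; congr (_ + _).
    rewrite [LHS]mxE [X in - X]mxE; congr (- (_ * _)).
    have -> : u *m (b^T *m b) *m u^T = (u *m b^T) *m (u *m b^T)^T.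
      by rewrite trmx_mul trmxK !mulmxA.
    by rewrite mxE big_ord1 [X in _ * X]mxE expr2.
  have -> : al * (- al^-1 * x) ^+ 2 + 2 * (- al^-1 * x) * x = - (al^-1 * x ^+ 2).
    by field; rewrite gt_eqF.
  rewrite addrC; apply.
  apply/eqP => /(congr1 (@rsubmx R 1 1 n)); rewrite row_mxKr => /rowP u0'.
  by move/eqP: u0; apply; apply/rowP => i; rewrite u0' !mxE.
pose c := Num.sqrt al.
have c0 : c != 0 by rewrite sqrtr_eq0 -ltNge.
have cc : c * c = al by rewrite -expr2 sqr_sqrtr // ltW.
pose L : 'M[R]_(1 + n) := block_mx c%:M 0 (c^-1 *: b^T) L'.
suff H : P' = L *m L^T by exists L.
rewrite [LHS]E /L tr_block_mx mulmx_block !trmx0 !mul0mx !mulmx0 !addr0.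
rewrite linearZ /= trmxK tr_scalar_mx -scalar_mxM cc.
rewrite mul_scalar_mx scalerA mulfV // scale1r mul_mx_scalar scalerA mulfV // scale1r.
rewrite -scalemxAl -scalemxAr scalerA -invfM cc -EL.
by rewrite addrC subrK.
Qed.

(** With [P = L L^T], the double sum becomes the sum of the values of the form [Q] at the rows of
    [L^T]. *)
Lemma trace_mul_ge0 n (P Q : 'M[R]_n) : P^T = P -> posdef P ->
  (forall u : 'rV[R]_n, 0 <= (u *m Q *m u^T) 0 0) ->
  0 <= \sum_k \sum_l P k l * Q k l.
Proof.
move=> sP /(cholesky sP)[L ->] pQ.
have -> : \sum_k \sum_l (L *m L^T) k l * Q k l =
    \sum_i (row i L^T *m Q *m (row i L^T)^T) 0 0.
  under eq_bigr => k _ do under eq_bigr => l _ do rewrite mxE mulr_suml.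
  under eq_bigr => k _ do rewrite exchange_big.
  rewrite exchange_big; apply: eq_bigr => i _.
  rewrite !mxE exchange_big /=; apply: eq_bigr => l _.
  rewrite !mxE mulr_suml; apply: eq_bigr => k _.
  by rewrite !mxE mulrAC.
by apply: sumr_ge0 => i _.
Qed.

End LinearAlgebra.

(** * The strong minimum principle *)

Section ContinuousMatrices.
Variables (R : realType) (T : topologicalType).
Implicit Types (x : T).

Lemma continuous_big_sum x (I : Type) (r : seq I) (P : pred I) (F : I -> T -> R) :
  (forall i, {for x, continuous (F i)}) ->
  {for x, continuous (fun y => \sum_(i <- r | P i) F i y)}.
Proof.
move=> cF; elim: r => [|i r IH].
  rewrite (_ : (fun y => _) = cst 0); first exact: cst_continuous.
  by apply/funext => y; rewrite big_nil.
case: (boolP (P i)) => Pi.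
  rewrite (_ : (fun y => _) = F i + (fun y => \sum_(j <- r | P j) F j y)).
    exact: continuousD.
  by apply/funext => y; rewrite big_cons Pi.
rewrite (_ : (fun y => _) = (fun y => \sum_(j <- r | P j) F j y)) //.
by apply/funext => y; rewrite big_cons (negbTE Pi).
Qed.

Lemma continuous_big_prod x (I : Type) (r : seq I) (P : pred I) (F : I -> T -> R) :
  (forall i, {for x, continuous (F i)}) ->
  {for x, continuous (fun y => \prod_(i <- r | P i) F i y)}.
Proof.
move=> cF; elim: r => [|i r IH].
  rewrite (_ : (fun y => _) = cst 1); first exact: cst_continuous.
  by apply/funext => y; rewrite big_nil.
case: (boolP (P i)) => Pi.
  rewrite (_ : (fun y => _) = F i \* (fun y => \prod_(j <- r | P j) F j y)).
    exact: continuousM.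
  by apply/funext => y; rewrite big_cons Pi.
rewrite (_ : (fun y => _) = (fun y => \prod_(j <- r | P j) F j y)) //.
by apply/funext => y; rewrite big_cons (negbTE Pi).
Qed.

Lemma continuous_mulmx x m n p (A : T -> 'M[R]_(m, n)) (B : T -> 'M[R]_(n, p)) i j :
  (forall i j, {for x, continuous (fun y => A y i j)}) ->
  (forall i j, {for x, continuous (fun y => B y i j)}) ->
  {for x, continuous (fun y => (A y *m B y) i j)}.
Proof.
move=> cA cB.
rewrite (_ : (fun y => _) = fun y => \sum_k A y i k * B y k j).
  by apply: continuous_big_sum => k; exact: continuousM.
by apply/funext => y; rewrite mxE.
Qed.

Lemma continuous_det x n (A : T -> 'M[R]_n) :
  (forall i j, {for x, continuous (fun y => A y i j)}) ->
  {for x, continuous (fun y => \det (A y))}.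
Proof.
move=> cA; apply: continuous_big_sum => s; apply: continuousM.
  exact: cst_continuous.
by apply: continuous_big_prod => i.
Qed.

Lemma continuous_invmx x n (A : T -> 'M[R]_n) i j :
  (forall i j, {for x, continuous (fun y => A y i j)}) -> A x \in unitmx ->
  {for x, continuous (fun y => invmx (A y) i j)}.
Proof.
move=> cA; rewrite unitmxE unitfE => Ax.
have cdet := continuous_det cA.
(* [invmx] is defined by cases; the cofactor formula describes it where the determinant is nonzero,
   hence near [x]. *)
apply: (@near_eq_continuous _ _ (fun y => (\det (A y))^-1 * cofactor (A y) j i)).
  have H := @cvgr_neq0 R R^o T (nbhs x) _ _ (\det (A x)) cdet Ax.
  apply: filterS (H _) => y dy.
  by rewrite /invmx unitmxE unitfE dy !mxE.
apply: continuousM; first exact: continuousV.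
apply: continuousM; first exact: cst_continuous.
apply: continuous_det => k l.
rewrite (_ : (fun y => _) = fun y => A y (lift j k) (lift i l)) //.
by apply/funext => y; rewrite !mxE.
Qed.

End ContinuousMatrices.

(** * The second derivative test, and Euclidean balls *)

Section MaximumPrinciple.
Variable R : realType.

(** If [f2 < 0], then [f1], which vanishes at 0, is negative just to the right of 0, and the mean
    value theorem makes [f] drop below [f 0] there. *)
Lemma second_derivative_min (f f1 : R -> R) (f2 : R) :
  (\forall t \near (0 : R), is_derive (t : R) 1 f (f1 t)) -> is_derive (0 : R) 1 f1 f2 ->
  (\forall t \near (0 : R), f 0 <= f t) -> f1 0 = 0 /\ 0 <= f2.
Proof.
move=> df df1 fmin.
have Unb : nbhs (0 : R) ([set t | is_derive (t : R) 1 f (f1 t)] `&` [set t | f 0 <= f t]).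
  exact: filterI.
have /nbhs_ballP[e /= e0 he] := Unb.
have inb (t : R) : `|t| < e -> ball (0 : R) e t.
  by move=> te; rewrite -ball_normE /ball_ /= sub0r normrN.
have inI (t : R) : t \in `](- e), e[%R -> `|t| < e.
  by rewrite in_itv /= ltr_norml.
have f10 : f1 0 = 0.
  have [||||dm ev] := @derive1_at_min _ f (- e) e 0.
  - by rewrite (@le_trans _ _ 0) // ?oppr_le0 ltW.
  - by move=> t /inI/inb/he[[]].
  - by rewrite in_itv /= oppr_lt0 e0.
  - by move=> t /inI/inb/he[].
  have [[d0 E0] _] : is_derive (0:R) 1 f (f1 0) /\ f 0 <= f 0.
    by apply: he; apply: inb; rewrite normr0.
  by rewrite -E0 ev.
split=> //; rewrite leNgt; apply/negP => f20.
have [d1 E1] := df1.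
have nf20 : 0 < - f2 by rewrite oppr_gt0.
have : \forall h \near (0 : R)^', `|f2 - h^-1 * f1 h| < - f2.
  have /cvgrPdist_lt/(_ _ nf20) := d1; rewrite -/('D_1 f1 0) E1.
  apply: filterS => h /=.
  by rewrite [h%:A]mulr1 addr0 f10 subr0.
rewrite near_withinE => Unb2.
have /nbhs_ballP[d /= d0 hd] : nbhs (0 : R)
  [set h : R | h != 0 -> `|f2 - h^-1 * f1 h| < - f2] by exact: Unb2.
pose t := Num.min e d / 2.
have t0 : 0 < t by rewrite divr_gt0 // lt_min e0.
have tlt : t < Num.min e d by rewrite ltr_pdivrMr // ltr_pMr ?ltr1n // lt_min e0.
have te : t < e by rewrite (lt_le_trans tlt) // ge_min lexx.
have td : t < d by rewrite (lt_le_trans tlt) // ge_min lexx orbT.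
have sm (s : R) : 0 <= s <= t -> `|s| < e.
  by move=> /andP[s0 st]; rewrite ger0_norm // (le_lt_trans st).
have [|s||c] := @MVT _ f f1 0 t.
- exact: t0.
- by rewrite in_itv /= => /andP[s0 st]; have [] := he _ (inb _ (sm s _)); rewrite ?ltW.
- apply: derivable_within_continuous => s; rewrite in_itv /= => sI.
  by have [[]] := he _ (inb _ (sm s sI)).
rewrite in_itv /= => /andP[c0 ct].
have ft : f 0 <= f t.
  have tt : 0 <= t <= t by rewrite lexx (ltW t0).
  by have [] := he _ (inb _ (sm t tt)).
rewrite subr0 => E.
have : 0 <= f1 c by rewrite -(pmulr_lge0 _ t0) -E subr_ge0.
apply/negP; rewrite -ltNge.
have : `|f2 - c^-1 * f1 c| < - f2.
  apply: hd; last by rewrite gt_eqF.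
  by rewrite -ball_normE /ball_ /= sub0r normrN gtr0_norm // (lt_trans ct).
rewrite ltr_norml => /andP[+ _].
by rewrite opprK ltrBrDl gtrDr pmulr_rlt0 // invr_gt0.
Qed.

(** The norm of ['rV[R]_n] is the sup norm, which is not smooth; the barrier is built on the
    Euclidean one, and the square is kept to avoid roots. *)
Definition normsq n (z : 'rV[R]_n) : R := \sum_k z 0 k ^+ 2.

Definition dotrow n (z w : 'rV[R]_n) : R := \sum_k z 0 k * w 0 k.

Lemma normsq_ge0 n (z : 'rV[R]_n) : 0 <= normsq z.
Proof. by apply: sumr_ge0 => k _; exact: sqr_ge0. Qed.

Lemma normsqN n (z : 'rV[R]_n) : normsq (- z) = normsq z.
Proof. by apply: eq_bigr => k _; rewrite mxE sqrrN. Qed.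

Lemma normsqD_le n (z w : 'rV[R]_n) : normsq (z + w) <= 2 * normsq z + 2 * normsq w.
Proof.
rewrite !mulr_sumr -big_split /=; apply: ler_sum => k _; rewrite mxE.
by have := sqr_ge0 (z 0 k - w 0 k); nra.
Qed.

Lemma entry_le_normsq n (z : 'rV[R]_n) k : z 0 k ^+ 2 <= normsq z.
Proof.
by rewrite /normsq (bigD1 k) //= lerDl; apply: sumr_ge0 => l _; exact: sqr_ge0.
Qed.

Lemma normsq_lineE n (z h : 'rV[R]_n) (t : R) :
  normsq (t *: h + z) = normsq z + t * (2 * dotrow z h) + t ^+ 2 * normsq h.
Proof.
rewrite /normsq /dotrow !mulr_sumr -!big_split /=; apply: eq_bigr => k _.
by rewrite !mxE; ring.
Qed.

Lemma normsq_continuous n (y : 'rV[R]_n) : continuous (fun x : 'rV[R]_n => normsq (x - y)).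
Proof.
move=> x; apply: continuous_big_sum => k.
rewrite (_ : (fun z : 'rV[R]_n => _) =
  ((fun z : 'rV[R]_n => z 0 k) - cst (y 0 k)) \* ((fun z : 'rV[R]_n => z 0 k) - cst (y 0 k))).
  by apply: continuousM; apply: continuousB;
    [exact: coord_continuous|exact: cst_continuous|exact: coord_continuous|exact: cst_continuous].
by apply/funext => z /=; rewrite !mxE expr2.
Qed.

Lemma mxnorm_lt n (z : 'rV[R]_n) (e : R) : 0 < e ->
  (forall k, `|z 0 k| < e) -> `|z| < e.
Proof.
move=> e0 H; rewrite /Num.Def.normr /= mx_normrE.
by apply/bigmax_ltP; split=> // -[i j] _ /=; rewrite ord1.
Qed.

Lemma normsq_nbhs n (x : 'rV[R]_n) (A : set 'rV[R]_n) : nbhs x A ->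
  exists2 s : R, 0 < s & [set z | normsq (z - x) <= s] `<=` A.
Proof.
move=> /nbhs_ballP[d /= d0 hd]; exists ((d / 2) ^+ 2).
  by rewrite exprn_gt0 // divr_gt0.
move=> z /= zs; apply: hd; rewrite -ball_normE /ball_ /= -normrN opprB.
apply: mxnorm_lt => // k.
have := le_trans (entry_le_normsq (z - x) k) zs.
rewrite -[X in X <= _]real_normK ?num_real //.
rewrite ler_sqr ?nnegrE ?divr_ge0 // ?(ltW d0) // => H.
by rewrite (le_lt_trans H) // ltr_pdivrMr // ltr_pMr // ltr1n.
Qed.

Lemma normsq_closed_ball_compact n (y : 'rV[R]_n) (s : R) (C : set 'rV[R]_n) :
  closed C -> compact (C `&` [set z | normsq (z - y) <= s]).
Proof.
move=> cC; apply: bounded_closed_compact.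
  (* From [t ^+ 2 <= s] follows [t < s + 1], a bound on the entries that is free of square roots. *)
  exists (`|y| + (s + 1)); split; first exact: num_real.
  move=> M hM z [_ /= zs]; rewrite -(subrK y z) (le_trans (ler_normD _ _)) //.
  apply: le_trans (ltW hM); rewrite addrC lerD2l ltW //.
  have s0 : 0 <= s by exact: le_trans (normsq_ge0 _) zs.
  apply: mxnorm_lt => [|k]; first by rewrite ltr_wpDl.
  have := le_trans (entry_le_normsq (z - y) k) zs.
  rewrite -[X in X <= _]real_normK ?num_real //.
  by have := normr_ge0 ((z - y) 0 k); nra.
apply: closedI => //.
apply: (@closed_comp _ _ (fun z : 'rV[R]_n => normsq (z - y)) [set t | t <= s]).
  by move=> z _; exact: normsq_continuous.
exact: closed_le.
Qed.

End MaximumPrinciple.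

Lemma continuous_near_gt (R : realType) (T : topologicalType) (f : T -> R) (x : T) (c : R) :
  {for x, continuous f} -> c < f x -> nbhs x [set y | c < f y].
Proof. by move=> cf cx; exact: (@cvgr_gt _ _ (nbhs x) _ _ _ cf). Qed.

Lemma continuous_near_lt (R : realType) (T : topologicalType) (f : T -> R) (x : T) (c : R) :
  {for x, continuous f} -> f x < c -> nbhs x [set y | f y < c].
Proof. by move=> cf cx; exact: (@cvgr_lt _ _ (nbhs x) _ _ _ cf). Qed.

(** * The barrier argument *)

Section StrongMaximumPrinciple.
Variables (R : realType) (n : nat).
Implicit Types (U : set 'rV[R]_n) (u : 'rV[R]_n -> R).

Lemma derive_line_within U u (x h : 'rV[R]_n) : open U -> Ck 2 U u -> U x ->
  (\forall t \near (0 : R),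
     is_derive (t : R) 1 (fun s : R => u (s *: h + x)) ('D_h u (t *: h + x))) /\
  is_derive (0 : R) 1 (fun t : R => 'D_h u (t *: h + x)) ('D_h ('D_h u) x).
Proof.
move=> oU Cu Ux; split.
  have : \forall t \near (0 : R), U (t *: h + x).
    by apply: near_line; exact: open_nbhs_nbhs.
  by apply: filterS => t Ut; apply: is_derive_line; exact: Ck_derivable Cu Ut.
have h0 : derivable ('D_h u) (0 *: h + x) h.
  by rewrite scale0r add0r; exact: Ck_derivable (Ck_derive _ Cu) Ux.
by apply: (is_derive_eq (is_derive_line h0)); rewrite scale0r add0r.
Qed.

Lemma derive2_row U u (x h : 'rV[R]_n) : open U -> Ck 2 U u -> U x ->
  'D_h ('D_h u) x =
  \sum_k \sum_l h 0 k * h 0 l * 'D_(delta_mx 0 k) ('D_(delta_mx 0 l) u) x.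
Proof.
move=> oU Cu Ux.
have Cu1 : Ck 1 U u by exact: CkW.
have -> : 'D_h ('D_h u) x = \sum_l h 0 l * 'D_h ('D_(delta_mx 0 l) u) x.
  have E : {near x, 'D_h u =1 \sum_l (fun y => h 0 l *: 'D_(delta_mx 0 l) u y)}.
    near=> y; rewrite fct_sumE; apply: (Ck_derive_row _ oU Cu1).
    by near: y; exact: open_nbhs_nbhs.
  rewrite (near_eq_derive _ E) derive_sum; last first.
    move=> l; apply: derivableZ; exact: Ck_derivable (Ck_derive _ Cu) Ux.
  apply: eq_bigr => l _; rewrite deriveZ //.
  exact: Ck_derivable (Ck_derive _ Cu) Ux.
transitivity (\sum_l \sum_k h 0 l * (h 0 k * 'D_(delta_mx 0 k) ('D_(delta_mx 0 l) u) x)).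
  apply: eq_bigr => l _; rewrite -mulr_sumr; congr (_ * _).
  exact: (Ck_derive_row h oU (Ck_derive _ Cu) Ux).
rewrite exchange_big; apply: eq_bigr => k _; apply: eq_bigr => l _ /=.
by rewrite mulrCA mulrA.
Unshelve. all: by end_near. Qed.

Lemma quadratic_formE (P : 'M[R]_n) (w : 'rV[R]_n) :
  (w *m P *m w^T) 0 0 = \sum_k \sum_l w 0 k * w 0 l * P k l.
Proof.
by rewrite bilinear_formE; apply: eq_bigr => k _; apply: eq_bigr => l _; rewrite mulrAC.
Qed.

(* The barrier is [exp (- al |x - y|^2) - exp (- al s)]: on the annulus
   [r <= |x - y|^2 <= s] it is a strict subsolution as soon as [al] is large, so
   [u - m] minus a small multiple of it has no interior minimum. Note that [r]
   and [s] are squared radii. *)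
Lemma positivity_propagation U u (P : 'rV[R]_n -> 'M[R]_n) (b : 'rV[R]_n -> 'rV[R]_n)
    (m r s : R) (y : 'rV[R]_n) :
  open U -> Ck 2 U u ->
  (forall x i j, U x -> {for x, continuous (fun z => P z i j)}) ->
  (forall x i, U x -> {for x, continuous (fun z => b z 0 i)}) ->
  (forall x, U x -> (P x)^T = P x) -> (forall x, U x -> posdef (P x)) ->
  (forall x, U x ->
     \sum_k \sum_l P x k l * 'D_(delta_mx 0 k) ('D_(delta_mx 0 l) u) x +
     \sum_k b x 0 k * 'D_(delta_mx 0 k) u x <= 0) ->
  (forall x, U x -> m <= u x) ->
  0 < r -> [set x | normsq (x - y) <= s] `<=` U ->
  (forall x, normsq (x - y) <= r -> U x -> m < u x) ->
  forall x, normsq (x - y) < s -> m < u x.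
Proof.
move=> oU Cu cP cb sP pP Lu mu r0 sU ru x0 x0s.
have q0E : normsq (y - y) = 0.
  by rewrite subrr /normsq big1 // => k _; rewrite mxE expr0n.
have Ux0 : U x0 by apply: sU; rewrite /= ltW.
have [x0r|x0r] := leP (normsq (x0 - y)) r; first exact: ru.
have rs : r < s by exact: lt_trans x0s.
pose K := [set x : 'rV[R]_n | r <= normsq (x - y)] `&` [set x | normsq (x - y) <= s].
have cK : compact K.
  apply: normsq_closed_ball_compact.
  apply: (@closed_comp _ _ (fun z : 'rV[R]_n => normsq (z - y)) [set t | r <= t]).
    by move=> z _; exact: normsq_continuous.
  exact: closed_ge.
have KU : K `<=` U by move=> x [_ /= /sU].
have K0 : K !=set0 by exists x0; split=> /=; exact: ltW.
(* The operator maps [exp (- al |x - y|^2)] to itself times [2 al (2 al den - num)], which is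
   positive as soon as [num < al den]. *)
pose den x := ((x - y) *m P x *m (x - y)^T) 0 0.
pose num x := \sum_k P x k k + \sum_k b x 0 k * (x - y) 0 k.
have den0 x : K x -> 0 < den x.
  move=> Kx; apply: pP; first exact: KU.
  apply/eqP => xy; case: Kx => /= + _; rewrite xy.
  by rewrite [normsq 0](_ : _ = 0) ?leNgt ?r0 // -{}q0E subrr.
have cdiff x k : {for x, continuous (fun z : 'rV[R]_n => (z - y) 0 k)}.
  rewrite (_ : (fun z => _) = (fun z : 'rV[R]_n => z 0 k) - cst (y 0 k)).
    by apply: continuousB; [exact: coord_continuous|exact: cst_continuous].
  by apply/funext => z /=; rewrite !mxE.
have [c cKc cmax] : exists2 c, c \in K & forall t, t \in K -> num t / den t <= num c / den c.
  apply: EVT_max_rV => //; apply: continuous_in_subspaceT => x /set_mem Kx.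
  have Ux := KU _ Kx.
  apply: continuousM.
    apply: continuousD; apply: continuous_big_sum => k; first exact: cP.
    by apply: continuousM; [exact: cb|exact: cdiff].
  apply: continuousV; first by rewrite gt_eqF // den0.
  rewrite (_ : den = fun x => \sum_k \sum_l (x - y) 0 k * (x - y) 0 l * P x k l).
    apply: continuous_big_sum => k; apply: continuous_big_sum => l.
    by apply: continuousM; [apply: continuousM; exact: cdiff|exact: cP].
  by apply/funext => z; rewrite /den quadratic_formE.
(* Any value above the maximum of [num / den] on the annulus would do; this one is also positive. *)
pose al := `|num c / den c| + 1.
have al0 : 0 < al by rewrite ltr_wpDl.
have alP x : K x -> num x < al * den x.
  move=> Kx; rewrite -ltr_pdivrMr ?den0 //.
  by rewrite (le_lt_trans (cmax x (mem_set Kx))) // (le_lt_trans (ler_norm _)) // ltrDl.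
pose Q := [set x : 'rV[R]_n | normsq (x - y) <= r].
have cu x : U x -> {for x, continuous u} by exact: Ck_cont Cu.
have QU : Q `<=` U by move=> x /= xr; apply: sU => /=; rewrite (le_trans xr) // ltW.
have [d dQ dmin] : exists2 d, d \in Q & forall t, t \in Q -> u d <= u t.
  apply: EVT_min_rV.
  - by exists y; rewrite /Q /= q0E ltW.
  - have := @normsq_closed_ball_compact _ _ y r setT closedT.
    by rewrite setTI.
  - by apply: continuous_in_subspaceT => x /set_mem /QU; exact: cu.
(* On the inner sphere [W <= 1] and [u - m >= e], so [phi >= m] there; on the outer sphere [W = 0],
   so [phi = u >= m]. *)
pose e := u d - m.
have e0 : 0 < e by rewrite subr_gt0; apply: ru; [exact: set_mem dQ|exact: QU (set_mem dQ)].
pose W (x : 'rV[R]_n) := expR (- al * normsq (x - y)) - expR (- al * s).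
pose phi x := u x - e * W x.
have cW x : {for x, continuous W}.
  have c1 : {for x, continuous (fun x : 'rV[R]_n => - al * normsq (x - y))}.
    apply: (@continuousM _ _ (cst (- al)) (fun x : 'rV[R]_n => normsq (x - y))).
      exact: cst_continuous.
    exact: normsq_continuous.
  have c2 : {for x, continuous (fun x : 'rV[R]_n => expR (- al * normsq (x - y)))}.
    exact: (continuous_comp c1 (@continuous_expR R _)).
  exact: (continuousB c2 (@cst_continuous _ _ (expR (- al * s)) x)).
have [x1 Kx1 x1min] : exists2 x1, x1 \in K & forall t, t \in K -> phi x1 <= phi t.
  apply: EVT_min_rV => //; apply: continuous_in_subspaceT => x /set_mem /KU Ux.
  have c1 : {for x, continuous (fun x => e * W x)}.
    exact: (continuousM (@cst_continuous _ _ e x) (cW x)).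
  exact: (continuousB (cu _ Ux) c1).
have {}Kx1 := set_mem Kx1.
have Ux1 := KU _ Kx1.
(* [W] is positive inside the outer sphere, so [m <= phi x0] forces [m < u x0]. *)
suff phi1 : m <= phi x1.
  have phi0 : m <= phi x0.
    by apply: (le_trans phi1); apply: x1min; apply/mem_set; split=> /=; exact: ltW.
  apply: (le_lt_trans phi0); rewrite /phi gtrBl mulr_gt0 // subr_gt0 ltr_expR.
  by rewrite ltr_nM2l // oppr_lt0.
case: (Kx1) => /= rx1 x1s.
have [qs|qs] := eqVneq (normsq (x1 - y)) s.
  by rewrite /phi /W qs subrr mulr0 subr0; exact: mu.
have {qs}x1s' : normsq (x1 - y) < s by rewrite lt_neqAle qs.
have [qr|qr] := eqVneq (normsq (x1 - y)) r.
  have ux1 : u d <= u x1 by apply: dmin; apply/mem_set; rewrite /Q /= qr.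
  have E1 : expR (- al * normsq (x1 - y)) <= 1.
    by rewrite -expR0 ler_expR mulNr oppr_le0 mulr_ge0 ?normsq_ge0 // ltW.
  have W1 : W x1 <= 1 by rewrite /W lerBlDr (le_trans E1) // lerDl expR_ge0.
  have eW : e * W x1 <= e by rewrite ler_piMr // ltW.
  by rewrite /phi; rewrite /e in eW *; lra.
have {qr}rx1' : r < normsq (x1 - y) by rewrite lt_neqAle eq_sym qr.
(* The remaining case is a minimum of [phi] inside the annulus: the gradient vanishes and the
   Hessian is nonnegative there, against the sign of the operator on [phi]. *)
exfalso.
set z := x1 - y in rx1' x1s'.
pose E := expR (- al * normsq z).
have E0 : 0 < E by exact: expR_gt0.
have key h : 'D_h u x1 = e * (- (2 * al * dotrow z h) * E) /\
    0 <= 'D_h ('D_h u) x1 - e * (4 * al ^+ 2 * dotrow z h ^+ 2 - 2 * al * normsq h) * E.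
  pose p t := - al * (normsq z + t * (2 * dotrow z h) + t ^+ 2 * normsq h).
  pose p1 t := - al * (2 * dotrow z h + t * (2 * normsq h)).
  have dp (t : R) : is_derive t 1 p (p1 t).
    rewrite /p /p1; apply: is_derive_eq.
    by rewrite /GRing.scale /=; ring.
  have dp1 (t : R) : is_derive t 1 p1 (- al * (2 * normsq h)).
    rewrite /p1; apply: is_derive_eq.
    by rewrite /GRing.scale /=; ring.
  have WE t : W (t *: h + x1) = expR (p t) - expR (- al * s).
    by rewrite /W -addrA normsq_lineE.
  have dexp (t : R) : is_derive t 1 (expR \o p) (p1 t * expR (p t)).
    by apply: is_derive_eq (is_derive1_comp (is_derive_expR _) (dp t)) _; rewrite mulrC.
  have [du ddu] := derive_line_within h oU Cu Ux1.
  have [] := @second_derivative_min _ (fun t => phi (t *: h + x1))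
     (fun t => 'D_h u (t *: h + x1) - e * (p1 t * expR (p t)))
     ('D_h ('D_h u) x1 - e * (- al * (2 * normsq h) * expR (p 0) + p1 0 * (p1 0 * expR (p 0)))).
  - have phiE : (fun t : R => phi (t *: h + x1)) =
        fun t => u (t *: h + x1) - e * ((expR \o p) t - expR (- al * s)).
      by apply/funext => t; rewrite /phi WE.
    apply: filterS du => t dut; rewrite phiE.
    by apply: is_derive_eq; rewrite /GRing.scale /=; ring.
  - apply: is_derive_eq; rewrite /GRing.scale /=; ring.
  - have Kn : nbhs x1 [set x | r < normsq (x - y) /\ normsq (x - y) < s].
      have cq : {for x1, continuous (fun x : 'rV[R]_n => normsq (x - y))}.
        exact: normsq_continuous.
      apply: (@filterI _ (nbhs x1)).
        exact: continuous_near_gt cq rx1'.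
      exact: continuous_near_lt cq x1s'.
    have := near_line h Kn; apply: filterS => t [t1 t2].
    rewrite scale0r add0r; apply: x1min; apply/mem_set.
    by split=> /=; exact: ltW.
  rewrite scale0r add0r.
  have -> : p 0 = - al * normsq z by rewrite /p; ring.
  rewrite /p1 mul0r addr0 -/E => H1 H2; split.
    by move/eqP: H1; rewrite subr_eq0 => /eqP ->; ring.
  by move: H2; congr (0 <= _); ring.
have Lx1 := Lu _ Ux1.
(* This is the Hessian of [phi] at [x1]; [trace_mul_ge0] will pair it with [P x1]. *)
pose H : 'M[R]_n := \matrix_(k, l) ('D_(delta_mx 0 k) ('D_(delta_mx 0 l) u) x1
   - e * (4 * al ^+ 2 * (z 0 k * z 0 l) - 2 * al * (k == l)%:R) * E).
have HE (C : 'I_n -> 'I_n -> R) : \sum_k \sum_l C k l * H k l =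
  \sum_k \sum_l C k l * 'D_(delta_mx 0 k) ('D_(delta_mx 0 l) u) x1
  - e * (4 * al ^+ 2 * (\sum_k \sum_l C k l * (z 0 k * z 0 l))
     - 2 * al * \sum_k C k k) * E.
  rewrite !mulr_sumr -!sumrB mulr_sumr mulr_suml -sumrB; apply: eq_bigr => k _.
  have -> : C k k = \sum_l C k l * (k == l)%:R.
    rewrite (bigD1 k) //= eqxx mulr1 big1 ?addr0 // => l lk.
    by rewrite eq_sym (negbTE lk) mulr0.
  rewrite !mulr_sumr -!sumrB mulr_sumr mulr_suml -sumrB; apply: eq_bigr => l _.
  by rewrite mxE; ring.
have Hpsd (w : 'rV[R]_n) : 0 <= (w *m H *m w^T) 0 0.
  have [_] := key w.
  rewrite (derive2_row _ oU Cu Ux1) quadratic_formE (HE (fun k l => w 0 k * w 0 l)).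
  have -> : dotrow z w ^+ 2 = \sum_k \sum_l w 0 k * w 0 l * (z 0 k * z 0 l).
    rewrite expr2 /dotrow big_distrlr; apply: eq_bigr => k _; apply: eq_bigr => l _ /=.
    by ring.
  by have -> : normsq w = \sum_k w 0 k * w 0 k by apply: eq_bigr => k _; rewrite expr2.
have tr := trace_mul_ge0 (sP _ Ux1) (pP _ Ux1) Hpsd.
have D1 k : 'D_(delta_mx 0 k) u x1 = e * (- (2 * al * z 0 k) * E).
  have dE l : (delta_mx 0 k : 'rV[R]_n) 0 l = (l == k)%:R by rewrite mxE eqxx.
  have [-> _] := key (delta_mx 0 k); rewrite /dotrow (bigD1 k) //= dE eqxx mulr1.
  by rewrite big1 ?addr0 // => l lk; rewrite dE (negbTE lk) mulr0.
have denE : den x1 = \sum_k \sum_l P x1 k l * (z 0 k * z 0 l).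
  rewrite /den quadratic_formE; apply: eq_bigr => k _; apply: eq_bigr => l _.
  by rewrite mulrC.
have bE : \sum_k b x1 0 k * 'D_(delta_mx 0 k) u x1 =
    - (e * E * (2 * al * \sum_k b x1 0 k * z 0 k)).
  rewrite !mulr_sumr -sumrN; apply: eq_bigr => k _; rewrite D1; ring.
have := alP _ Kx1; have := den0 _ Kx1; rewrite /num -/z.
move: Lx1 tr; rewrite (HE (P x1)) bE -denE.
set A1 := \sum_k \sum_l _; set B1 := \sum_k b x1 0 k * _; set T1 := \sum_k P x1 k k.
move=> Lx1 tr denx alPx.
(* [Lx1] and [tr] together say that the sum of the two quantities in [h1] and [h2] is at most 0; the
   term [2 al den] is split evenly between them. *)
have h1 : 0 < e * E * (2 * al) * (al * den x1 - (T1 + B1)).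
  by rewrite !mulr_gt0 // subr_gt0.
have h2 : 0 < e * E * (2 * al) * (al * den x1) by rewrite !mulr_gt0.
lra.
Qed.

(** If [u > m] at a point [y] close to [x0], then by continuity also on a small ball around [y], and
    positivity propagates to a larger ball that contains [x0], where [u] equals [m]. *)
Lemma strong_minimum_principle U u (P : 'rV[R]_n -> 'M[R]_n)
    (b : 'rV[R]_n -> 'rV[R]_n) (m : R) (x0 : 'rV[R]_n) :
  open U -> Ck 2 U u ->
  (forall x i j, U x -> {for x, continuous (fun z => P z i j)}) ->
  (forall x i, U x -> {for x, continuous (fun z => b z 0 i)}) ->
  (forall x, U x -> (P x)^T = P x) -> (forall x, U x -> posdef (P x)) ->
  (forall x, U x ->
     \sum_k \sum_l P x k l * 'D_(delta_mx 0 k) ('D_(delta_mx 0 l) u) x +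
     \sum_k b x 0 k * 'D_(delta_mx 0 k) u x <= 0) ->
  (forall x, U x -> m <= u x) -> U x0 -> u x0 = m ->
  \forall x \near x0, u x = m.
Proof.
move=> oU Cu cP cb sP pP Lu mu Ux0 ux0.
have [s s0 sU] : exists2 s : R, 0 < s & [set z | normsq (z - x0) <= s] `<=` U.
  by apply: normsq_nbhs; exact: open_nbhs_nbhs.
have s4 : 0 < s / 4 by rewrite divr_gt0.
have q0 : normsq (x0 - x0) = 0.
  by rewrite subrr /normsq big1 // => k _; rewrite mxE expr0n.
have : \forall y \near x0, normsq (y - x0) < s / 4.
  have cq : {for x0, continuous (fun x : 'rV[R]_n => normsq (x - x0))}.
    exact: normsq_continuous.
  by apply: (continuous_near_lt cq); rewrite q0.
apply: filterS => y ys.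
(* By [normsqD_le], a point of this ball is within squared distance [2 (s / 4) + 2 (s / 4) = s] of
   [x0]. *)
have yU : [set x | normsq (x - y) <= s / 4] `<=` U.
  move=> x /= xs; apply: sU => /=; rewrite -(subrKA y).
  by apply: (le_trans (normsqD_le _ _)); lra.
have Uy : U y.
  by apply: yU => /=; rewrite subrr -(subrr x0) q0 ltW.
apply/eqP; rewrite eq_le mu // andbT leNgt; apply/negP => muy.
have [r r0 rm] : exists2 r : R, 0 < r & [set z | normsq (z - y) <= r] `<=` [set z | m < u z].
  apply: normsq_nbhs; exact: (continuous_near_gt (Ck_cont Cu Uy) muy).
have := @positivity_propagation U u P b m r (s / 4) y oU Cu cP cb sP pP Lu mu r0 yU.
move=> /(_ (fun x xr _ => rm x xr) x0); rewrite ux0 ltxx => H; apply: notF; apply: H.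
by rewrite -opprB normsqN.
Qed.

End StrongMaximumPrinciple.

(** * The equation of the height function *)

Section HypersurfaceAlgebra.
Variables (R : realType) (n : nat).
Variables (J : 'M[R]_(n, n + 1)) (G : 'M[R]_(n + 1)) (Nv : 'rV[R]_(n + 1)).
Hypothesis sG : G^T = G.
Hypothesis uG : G \in unitmx.
Hypothesis uJ : J *m G *m J^T \in unitmx.
Hypothesis JN : J *m G *m Nv^T = 0.
Hypothesis NN : Nv *m G *m Nv^T = 1%:M.

Let a := invmx (J *m G *m J^T).

(** The frame made of the rows of [J] and of [Nv] has the block diagonal Gram matrix with blocks
    [J G J^T] and 1; inverting this relation expresses the inverse of [G] in the frame. *)
Lemma normal_frame_inverse : (J^T *m a *m J + Nv^T *m Nv) *m G = 1%:M.
Proof.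
have NJ : Nv *m G *m J^T = 0.
  by apply: trmx_inj; rewrite !trmx_mul trmxK sG mulmxA JN trmx0.
pose B : 'M[R]_(n + 1) := col_mx J Nv.
have H : B *m (G *m (B^T *m block_mx a 0 0 1%:M)) = 1%:M.
  rewrite !mulmxA /B mul_col_mx tr_col_mx mul_col_row JN NN NJ mulmx_block.
  rewrite mulmxV // !mul0mx !mulmx0 mulmx1 !addr0 add0r.
  by rewrite -scalar_mx_block.
have E : B^T *m block_mx a 0 0 1%:M *m B = J^T *m a *m J + Nv^T *m Nv.
  by rewrite /B tr_col_mx mul_row_block !mulmx0 mulmx1 addr0 add0r mul_row_col.
by have := mulmx1C H; rewrite -(mulmxA G _ B) E => /mulmx1C.
Qed.

(** [e] stands for the vertical vector, which is its own metric dual. It splits into a tangential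
    and a normal part, the covector [w] annihilates the latter, and [J *m e] will be the
    differential of the height. *)
Lemma fixed_vector_normal_frame (w : 'rV[R]_(n + 1)) (e : 'cV[R]_(n + 1)) :
  w *m Nv^T = 0 -> G *m e = e -> w *m e = w *m J^T *m a *m (J *m e).
Proof.
move=> wN Ge.
have Se : (J^T *m a *m J + Nv^T *m Nv) *m e = e.
  by rewrite -{1}Ge mulmxA normal_frame_inverse mul1mx.
by rewrite -{1}Se mulmxDl mulmxDr !mulmxA wN !mul0mx addr0.
Qed.

Variables (dG : 'I_(n + 1) -> 'M[R]_(n + 1)) (H : 'I_n -> 'I_n -> 'rV[R]_(n + 1)).
Variables (dN : 'I_n -> 'rV[R]_(n + 1)) (Pv : 'rV[R]_(n + 1)).
Hypothesis sdG : forall b, (dG b)^T = dG b.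

(* [H], [dG], [dN] and [Pv] stand for the second derivatives of the immersion and
   the first derivatives of the metric, the normal and the weight. The entry [e]
   of [christoffel1 b d] is the Christoffel symbol of the first kind with [e] as
   distinguished index, and [second_form k l] is the covector obtained by lowering
   the covariant derivative of the [l]-th tangent vector along the [k]-th. *)
Definition christoffel1 (b d : 'I_(n + 1)) : 'rV[R]_(n + 1) :=
  \row_e (2^-1 * (dG b e d + dG d e b - dG e b d)).

Lemma christoffel1_eq0 b d e : dG b e d = 0 -> dG d e b = 0 -> dG e = 0 ->
  christoffel1 b d 0 e = 0.
Proof. by move=> E1 E2 E3; rewrite mxE E1 E2 E3 mxE subr0 addr0 mulr0. Qed.

Definition second_form (k l : 'I_n) : 'rV[R]_(n + 1) :=
  H k l *m G + \sum_b \sum_d (J k b * J l d) *: christoffel1 b d.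

(** Up to tangential terms, this is the mean curvature vector with its index lowered: the
    Christoffel symbols of the induced metric, which would only change first order coefficients, are
    left out. *)
Definition tension : 'rV[R]_(n + 1) :=
  \sum_k \sum_l a k l *: second_form k l.

(** [christ] and [covN] repeat the bodies of [christoffel] and [cov], with the derivatives
    abstracted, so that weighted minimality yields [minN] by conversion. *)
Let christ al b d := \sum_(e < n + 1) 2^-1 * invmx G al e *
    (dG b e d + dG d e b - dG e b d).
Let covN k : 'rV[R]_(n + 1) :=
  \row_al (dN k 0 al + \sum_b \sum_d christ al b d * J k b * Nv 0 d).

Hypothesis diffN : forall k l,
  (H k l *m G *m Nv^T) 0 0 + (row l J *m (\sum_c J k c *: dG c) *m Nv^T) 0 0 +
  (row l J *m G *m (dN k)^T) 0 0 = 0.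
Hypothesis minN :
  - (\sum_k \sum_l a k l * inner G (covN k) (row l J)) -
    inner G (Pv *m invmx G) Nv = 0.

Lemma covN_lower k :
  covN k *m G = dN k *m G + \sum_b \sum_d (J k b * Nv 0 d) *: christoffel1 b d.
Proof.
have sI : (invmx G)^T = invmx G by rewrite trmx_inv sG.
have -> : covN k = dN k +
    \sum_b \sum_d (J k b * Nv 0 d) *: (christoffel1 b d *m invmx G).
  apply/rowP => al; rewrite !mxE summxE; congr (_ + _); apply: eq_bigr => b _.
  rewrite summxE; apply: eq_bigr => d _.
  rewrite [RHS]mxE [X in _ = _ * X]mxE /christ mulr_suml mulr_suml mulr_sumr.
  apply: eq_bigr => e _; rewrite !mxE -[in RHS]sI [in RHS]mxE; ring.
rewrite mulmxDl mulmx_suml; congr (_ + _); apply: eq_bigr => b _.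
rewrite mulmx_suml; apply: eq_bigr => d _.
by rewrite -scalemxAl -mulmxA mulVmx // mulmx1.
Qed.

(** [diffN] is the derivative of the orthogonality of the [l]-th tangent vector and the normal; here
    it is rewritten with covariant derivatives. *)
Lemma weingarten k l :
  inner G (covN k) (row l J) + (second_form k l *m Nv^T) 0 0 = 0.
Proof.
have addE (X Y : 'M[R]_1) : (X + Y) 0 0 = X 0 0 + Y 0 0 by rewrite mxE.
have tr1 (X : 'M[R]_1) : X^T 0 0 = X 0 0 by rewrite mxE.
(* Compatibility of the connection with the metric: [christoffel1 b d] at [e] plus
   [christoffel1 b e] at [d] is [dG b e d]. *)
suff E : ((\sum_b \sum_d (J k b * Nv 0 d) *: christoffel1 b d) *m (row l J)^T) 0 0 +
    ((\sum_b \sum_d (J k b * J l d) *: christoffel1 b d) *m Nv^T) 0 0 =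
    (row l J *m (\sum_c J k c *: dG c) *m Nv^T) 0 0.
  rewrite /inner covN_lower /second_form !mulmxDl !addE -[RHS](diffN k l) -E.
  have -> : (dN k *m G *m (row l J)^T) 0 0 = (row l J *m G *m (dN k)^T) 0 0.
    by rewrite -tr1 !trmx_mul trmxK sG mulmxA.
  by ring.
rewrite !mulmx_suml mulmx_sumr mulmx_suml !summxE -big_split /=.
apply: eq_bigr => b _.
rewrite -scalemxAr -scalemxAl [RHS]mxE.
rewrite !mulmx_suml !summxE.
have -> : (row l J *m dG b *m Nv^T) 0 0 = \sum_d \sum_e J l e * dG b e d * Nv 0 d.
  rewrite mxE; apply: eq_bigr => d _; rewrite mxE mulr_suml; apply: eq_bigr => e _.
  by rewrite !mxE.
have -> : \sum_d ((J k b * Nv 0 d) *: christoffel1 b d *m (row l J)^T) 0 0 =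
   \sum_d \sum_e J k b * Nv 0 d * (2^-1 * (dG b e d + dG d e b - dG e b d)) * J l e.
  by apply: eq_bigr => d _; rewrite mxE; apply: eq_bigr => e _; rewrite !mxE.
have -> : \sum_d ((J k b * J l d) *: christoffel1 b d *m Nv^T) 0 0 =
   \sum_d \sum_e J k b * J l e * (2^-1 * (dG b d e + dG e d b - dG d b e)) * Nv 0 d.
  rewrite exchange_big /=.
  by apply: eq_bigr => d _; rewrite mxE; apply: eq_bigr => e _; rewrite !mxE.
rewrite -big_split mulr_sumr; apply: eq_bigr => d _ /=.
rewrite -big_split mulr_sumr; apply: eq_bigr => e _ /=.
have sd x y z : dG x y z = dG x z y by rewrite -[in LHS]sdG mxE.
rewrite (sd b d e) (sd d b e) (sd e d b).
by field.
Qed.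

(** Tracing [weingarten] shows that [tension] paired with [Nv] is minus the tangential divergence of
    the normal, so this is the minimality equation. *)
Lemma tension_normal : (tension - Pv) *m Nv^T = 0.
Proof.
apply/matrixP => i j; rewrite !ord1 mulmxBl.
have subE (X Y : 'M[R]_1) : (X - Y) 0 0 = X 0 0 - Y 0 0 by rewrite !mxE.
rewrite subE [RHS]mxE.
have -> : (tension *m Nv^T) 0 0 = \sum_k \sum_l a k l * (second_form k l *m Nv^T) 0 0.
  rewrite /tension mulmx_suml summxE; apply: eq_bigr => k _.
  rewrite mulmx_suml summxE; apply: eq_bigr => l _.
  by rewrite -scalemxAl mxE.
have -> : (Pv *m Nv^T) 0 0 = inner G (Pv *m invmx G) Nv.
  by rewrite /inner -[Pv *m _ *m _]mulmxA mulVmx // mulmx1.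
rewrite -[RHS]minN -sumrN; congr (_ - _); apply: eq_bigr => k _.
rewrite -sumrN; apply: eq_bigr => l _.
rewrite -mulrN; congr (_ * _).
by have /eqP := weingarten k l; rewrite addrC addr_eq0 => /eqP.
Qed.

Lemma tension_equation (e : 'cV[R]_(n + 1)) : G *m e = e ->
  (tension *m e) 0 0 = (Pv *m e) 0 0 +
    ((tension - Pv) *m J^T *m a *m (J *m e)) 0 0.
Proof.
move=> Ge; rewrite -(fixed_vector_normal_frame tension_normal Ge).
have addE (X Y : 'M[R]_1) : X 0 0 + Y 0 0 = (X + Y) 0 0 by rewrite mxE.
by rewrite addE -mulmxDl addrC subrK.
Qed.

End HypersurfaceAlgebra.

(** * One-sided partial derivatives and smooth extensions *)

Section OneSidedPartials.
Variable R : realType.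

(** This lets the one-sided derivatives of [partial] be computed on any smooth extension; open sets
    and relatively open parts of the half-space have the property. *)
Definition forward_stable n (A : set 'rV[R]_n) := forall x, A x ->
  forall k, \forall t \near (0 : R)^'+, A (x + t *: delta_mx 0 k).

Lemma near_right_line (V : normedModType R) (U : set V) (x v : V) :
  nbhs x U -> \forall t \near (0 : R)^'+, U (x + t *: v).
Proof.
move=> Ux; have := near_line v Ux => H.
have H' : \forall t \near (0 : R), U (x + t *: v).
  by apply: filterS H => t; rewrite addrC.
exact: (@cvg_within _ (nbhs (0 : R)) _ _ _ H').
Qed.

Lemma open_forward_stable n (A : set 'rV[R]_n) : open A -> forward_stable A.
Proof. by move=> oA x Ax k; apply: near_right_line; exact: open_nbhs_nbhs. Qed.

Lemma half_space_forward_stable n (O : set 'rV[R]_n) : open O ->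
  forward_stable (@half_space R n `&` O).
Proof.
move=> oO x [hx Ox] k.
have H : \forall t \near (0 : R)^'+, O (x + t *: delta_mx 0 k).
  by apply: near_right_line; exact: open_nbhs_nbhs.
have H2 : \forall t \near (0 : R)^'+, 0 < t by exact: nbhs_right_gt.
near=> t; split; last by near: t.
have t0 : 0 < t by near: t.
move=> i i0; rewrite !mxE addr_ge0 ?hx // mulr_ge0 ?ler0n // ltW //.
Unshelve. all: by end_near. Qed.

Lemma rderive_extension (V W : normedModType R) (A B : set V) (f fe : V -> W)
    (y v : V) :
  open B -> A y -> B y -> (forall z, A z -> B z -> f z = fe z) ->
  (\forall t \near (0 : R)^'+, A (y + t *: v)) -> derivable fe y v ->
  rderive f y v = 'D_v fe y.
Proof.
move=> oB Ay By E hA dfe.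
have hB : \forall t \near (0 : R)^'+, B (y + t *: v).
  by apply: near_right_line; exact: open_nbhs_nbhs.
have Eq : \forall t \near (0 : R)^'+,
   t^-1 *: (f (y + t *: v) - f y) = t^-1 *: ((fe \o shift y) (t *: v) - fe y).
  near=> t; rewrite /= (addrC (t *: v)) !E //; by near: t.
rewrite /rderive /derive cvg_at_rightE //; congr (lim _).
rewrite eqEsubset; split; apply: near_eq_cvg => //.
by apply: filterS Eq => t ->.
Unshelve. all: by end_near. Qed.

Lemma smooth_on_partial n (W : normedModType R) (A : set 'rV[R]_n)
    (f : 'rV[R]_n -> W) y :
  forward_stable A -> smooth_on A f -> A y ->
  exists (B : set 'rV[R]_n) (fe : 'rV[R]_n -> W),
    [/\ open B, B y, forall k, Ck k B fe, forall z, A z -> B z -> f z = fe z &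
      forall z k, A z -> B z -> partial f z k = 'D_(delta_mx 0 k) fe z].
Proof.
move=> sA sf Ay; have [B [fe [oB By Cfe E]]] := sf y Ay.
have E' z : A z -> B z -> f z = fe z by move=> Az Bz; exact: E.
exists B, fe; split=> // z k Az Bz.
by apply: rderive_extension E' _ _ => //; [exact: sA|exact: Ck_derivable (Cfe 1%N) Bz].
Qed.

Lemma smooth_on_open n (W : normedModType R) (A U : set 'rV[R]_n)
    (f : 'rV[R]_n -> W) k :
  open U -> U `<=` A -> smooth_on A f -> Ck k U f.
Proof.
move=> oU UA sf; apply: Ck_local => // x Ux.
have [B [fe [oB Bx Cfe E]]] := sf x (UA _ Ux).
by exists B, fe; split=> // y By Uy; apply: E => //; exact: UA.
Qed.

Lemma smooth_on_entry n p q (A : set 'rV[R]_n) (f : 'rV[R]_n -> 'M[R]_(p, q)) i j :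
  smooth_on A f -> smooth_on A (fun x => f x i j).
Proof.
move=> sf x Ax; have [B [fe [oB Bx Cfe E]]] := sf x Ax.
exists B, (fun x => fe x i j); split=> // [k|y Ay By]; first exact: Ck_entry.
by rewrite E.
Qed.

Lemma partial_entry n p q (A : set 'rV[R]_n) (f : 'rV[R]_n -> 'M[R]_(p, q)) z k i j :
  forward_stable A -> smooth_on A f -> A z ->
  partial f z k i j = partial (fun x => f x i j) z k.
Proof.
move=> sA sf Az; have [B [fe [oB Bz Cfe E Ep]]] := smooth_on_partial sA sf Az.
rewrite Ep // derive_mx ?mxE; last exact: Ck_derivable (Cfe 1%N) Bz.
rewrite /partial; symmetry; apply: (rderive_extension oB Az Bz).
- by move=> y Ay By; rewrite E.
- exact: sA.
- by apply: Ck_derivable (Ck_entry i j oB (Cfe 1%N)) Bz.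
Qed.

Lemma smooth_comp_continuous (T : topologicalType) n (A : set 'rV[R]_n)
    (f : 'rV[R]_n -> R) (F : T -> 'rV[R]_n) (x0 : T) k :
  forward_stable A -> smooth_on A f -> {for x0, continuous F} ->
  (\forall x \near x0, A (F x)) ->
  {for x0, continuous (fun x => partial f (F x) k)}.
Proof.
move=> sA sf cF nA.
have A0 : A (F x0) by exact: nbhs_singleton nA.
have [B [fe [oB B0 Cfe E Ep]]] := smooth_on_partial sA sf A0.
have nB : \forall x \near x0, B (F x) by apply: cF; exact: open_nbhs_nbhs.
apply: (@near_eq_continuous _ _ ('D_(delta_mx 0 k) fe \o F)).
  by apply: filterS2 nA nB => x Ax Bx /=; rewrite Ep.
apply: continuous_comp => //.
exact: Ck_cont (Ck_derive _ (Cfe 1%N)) B0.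
Qed.

(** [F x0] may lie on the edge of [A]. Since [F] stays in [A] near [x0], a smooth extension of [f]
    can replace it before the chain rule is applied, and its partial derivatives are the one-sided
    ones of [f]. *)
Lemma smooth_comp_derive (X : normedModType R) n (A : set 'rV[R]_n)
    (f : 'rV[R]_n -> R) (F : X -> 'rV[R]_n) (x0 v : X) :
  forward_stable A -> smooth_on A f -> {for x0, continuous F} ->
  (\forall x \near x0, A (F x)) -> derivable F x0 v ->
  is_derive x0 v (fun x => f (F x))
    (\sum_k 'D_v F x0 0 k * partial f (F x0) k).
Proof.
move=> sA sf cF nA dF.
have A0 : A (F x0) by exact: nbhs_singleton nA.
have [B [fe [oB B0 Cfe E Ep]]] := smooth_on_partial sA sf A0.
have nB : \forall x \near x0, B (F x) by apply: cF; exact: open_nbhs_nbhs.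
have -> : \sum_k 'D_v F x0 0 k * partial f (F x0) k = 'D_('D_v F x0) fe (F x0).
  rewrite (Ck_derive_row _ oB (Cfe 1%N) B0); apply: eq_bigr => k _.
  by rewrite Ep.
apply: (@near_eq_is_derive _ _ _ (fe \o F)).
  by apply: filterS2 nA nB => x Ax Bx /=; rewrite E.
apply: chain_rule dF; exact: Ck_differentiable oB (Cfe 1%N) B0.
Qed.

Lemma smooth_comp_continuous0 (T : topologicalType) n (A : set 'rV[R]_n)
    (f : 'rV[R]_n -> R) (F : T -> 'rV[R]_n) (x0 : T) :
  smooth_on A f -> {for x0, continuous F} ->
  (\forall x \near x0, A (F x)) ->
  {for x0, continuous (fun x => f (F x))}.
Proof.
move=> sf cF nA.
have A0 : A (F x0) by exact: nbhs_singleton nA.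
have [B [fe [oB B0 Cfe E]]] := sf _ A0.
have nB : \forall x \near x0, B (F x) by apply: cF; exact: open_nbhs_nbhs.
apply: (@near_eq_continuous _ _ (fe \o F)).
  by apply: filterS2 nA nB => x Ax Bx /=; rewrite E.
by apply: continuous_comp => //; exact: Ck_cont (Cfe 0%N) B0.
Qed.

Lemma smooth_on_lin (V V' W : normedModType R) (A : set V') (f : V' -> W)
    (L : {linear V -> V'}) :
  continuous L -> smooth_on A f -> smooth_on (L @^-1` A) (f \o L).
Proof.
move=> cL sf x /= Ax; have [B [fe [oB Bx Cfe E]]] := sf _ Ax.
exists (L @^-1` B), (fe \o L); split=> //.
- by apply: open_comp => // y _; exact: cL.
- by move=> k; exact: Ck_comp_linear.
- by move=> y Ay By /=; rewrite E.
Qed.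

Lemma smooth_onD (V W : normedModType R) (A : set V) (f h : V -> W) :
  smooth_on A f -> smooth_on A h -> smooth_on A (fun x => f x + h x).
Proof.
move=> sf sh x Ax; have [B [fe [oB Bx Cfe E]]] := sf _ Ax.
have [C [he [oC Cx Che E2]]] := sh _ Ax.
exists (B `&` C), (fun x => fe x + he x); split=> //.
- exact: openI.
- move=> k; apply: CkD; first exact: openI.
    by apply: Ck_subset (Cfe k); exact: subIsetl.
  by apply: Ck_subset (Che k); exact: subIsetr.
- by move=> y Ay [By Cy]; rewrite E // E2.
Qed.

Lemma smooth_on_mx (V : normedModType R) p q (A : set V) (f : V -> 'M[R]_(p, q)) :
  (forall i j, smooth_on A (fun x => f x i j)) -> smooth_on A f.
Proof.
move=> sf x Ax.
have H (ij : 'I_p * 'I_q) : exists Bf : set V * (V -> R),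
    [/\ open Bf.1, Bf.1 x, forall k, Ck k Bf.1 Bf.2 &
      forall y, A y -> Bf.1 y -> f y ij.1 ij.2 = Bf.2 y].
  by have [B [fe HB]] := sf ij.1 ij.2 x Ax; exists (B, fe).
have [Bf HB] := choice H.
pose B := [set y | forall ij, (Bf ij).1 y].
have nB y : B y -> nbhs y B.
  move=> By; apply: (@filter_forall _ _ (fun ij => (Bf ij).1) (nbhs y) _) => ij.
  by apply: open_nbhs_nbhs; split; [case: (HB ij)|exact: By].
have oB : open B by rewrite openE => y /nB.
exists B, (fun y => \matrix_(i, j) (Bf (i, j)).2 y); split=> //.
- by move=> ij; case: (HB ij).
- move=> k; apply: Ck_mx => // i j.
  rewrite (_ : (fun y => _) = (Bf (i, j)).2); last by apply/funext => y; rewrite mxE.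
  have [_ _ C _] := HB (i, j); apply: Ck_subset (C k) => y; exact.
- move=> y Ay By; apply/matrixP => i j; rewrite mxE.
  by have [_ _ _ ->] := HB (i, j); last exact: By.
Qed.

End OneSidedPartials.

(** * Metric and weight of the cylinder in a chart *)

Section CylinderCalculus.
Variable R : realType.

Lemma partial_eq_on n (W : normedModType R) (A : set 'rV[R]_n)
    (f f' : 'rV[R]_n -> W) y k :
  forward_stable A -> A y -> (forall z, A z -> f z = f' z) ->
  partial f y k = partial f' y k.
Proof.
move=> sA Ay E; rewrite /partial /rderive; congr (lim _).
have Eq : \forall t \near (0 : R)^'+, t^-1 *: (f (y + t *: delta_mx 0 k) - f y)
    = t^-1 *: (f' (y + t *: delta_mx 0 k) - f' y).
  by apply: filterS (sA y Ay k) => t At; rewrite !E.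
rewrite eqEsubset; split; apply: near_eq_cvg => //.
by apply: filterS Eq => t ->.
Qed.

Lemma rderive_cst_along (V W : normedModType R) (f : V -> W) (y v : V) :
  (forall t : R, f (y + t *: v) = f y) -> rderive f y v = 0.
Proof.
move=> E; rewrite /rderive (_ : (fun t => _) = cst 0); first exact: lim_cst.
by apply/funext => t; rewrite E subrr scaler0.
Qed.

Lemma lsubmx_delta_last n : lsubmx (delta_mx 0 (rshift n 0) : 'rV[R]_(n + 1)) = 0.
Proof.
by apply/rowP => j; rewrite !mxE eqxx /= eq_lrshift.
Qed.

Lemma smooth_on_cst (V W : normedModType R) (A : set V) (w : W) :
  smooth_on A (fun _ => w).
Proof.
move=> x Ax; exists setT, (fun _ => w); split=> //; first exact: openT.
by move=> k; exact: Ck_cst.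
Qed.

(** When [0 < n], the distinguished coordinate of the cylinder is that of [M], so a half-space chart
    of [M] gives one of the cylinder; for [n = 0] it would be the height. *)
Lemma forward_stable_cyl n (B O : set 'rV[R]_n) : (0 < n)%N -> open O ->
  B = @half_space R n `&` O ->
  forward_stable (lsubmx @^-1` B : set 'rV[R]_(n + 1)).
Proof.
move=> n0 oO ->.
rewrite (_ : _ @^-1` _ = @half_space R (n + 1) `&` (lsubmx @^-1` O)).
  apply: half_space_forward_stable; apply: open_comp => // y _.
  exact: continuous_lsubmx.
rewrite preimage_setI; congr (_ `&` _); apply/seteqP; split=> y /= hy i i0.
  have := hy (Ordinal n0) erefl; rewrite mxE; congr (0 <= y 0 _).
  by apply: val_inj; rewrite /= i0.
by rewrite mxE; apply: hy.
Qed.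

Lemma cyl_metric_smooth n (M : Type) (A : atlas R n M) (g : metric A) i :
  smooth_on (cod i) (g i) ->
  smooth_on (lsubmx @^-1` cod i) (cyl_metric g i : 'rV[R]_(n + 1) -> 'M[R]_(n + 1)).
Proof.
move=> sg; apply: smooth_on_mx => k l.
rewrite (_ : (fun x => _) = fun x : 'rV[R]_(n + 1) =>
   match fintype.split k, fintype.split l with
   | inl a, inl b => g i (lsubmx x) a b
   | inr a, inr b => (1%:M : 'M[R]_1) a b
   | _, _ => 0 end); last first.
  apply/funext => x; rewrite /cyl_metric /block_mx !mxE; case: fintype.split => a; rewrite !mxE;
    by case: fintype.split => b; rewrite ?mxE.
case: (fintype.split k) => a; case: (fintype.split l) => b; try exact: smooth_on_cst.
exact: (smooth_on_lin (L := lsubmx) (@continuous_lsubmx _ _ _ _) (smooth_on_entry a b sg)).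
Qed.

Lemma cyl_psi_smooth n (M : Type) (A : atlas R n M) (h : M -> R) (v : R -> R)
    (psi : M * R -> R) (i : chart A) :
  smooth_fun A h -> smooth_on [set: R] v ->
  (forall p t, psi (p, t) = h p + v t) ->
  smooth_on (lsubmx @^-1` cod i : set 'rV[R]_(n + 1)) (psi \o param (a := cyl_atlas A) i).
Proof.
move=> sh sv hpsi.
have Llin : linear (fun y : 'rV[R]_(n + 1) => rsubmx y 0 0 : R).
  by move=> c y z; rewrite !mxE.
pose L : {linear 'rV[R]_(n + 1) -> R} :=
  HB.pack (fun y : 'rV[R]_(n + 1) => rsubmx y 0 0 : R) (GRing.isLinear.Build _ _ _ _ _ Llin).
have cL : continuous L.
  have -> : (L : 'rV[R]_(n + 1) -> R) = fun y => y 0 (rshift n 0).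
    by apply/funext => y; rewrite /= mxE.
  exact: coord_continuous.
have -> : psi \o param (a := cyl_atlas A) i =
   fun y => ((h \o param i) \o lsubmx) y + (v \o L) y.
  by apply/funext => y; rewrite /= hpsi.
apply: smooth_onD.
  exact: (smooth_on_lin (L := lsubmx) (@continuous_lsubmx _ _ _ _) (sh i)).
move=> y Ay; have [B [fe H]] := smooth_on_lin cL sv (x := y) I.
by exists B, fe; case: H => oB By C E; split=> // z _; exact: E.
Qed.

(** The last direction moves the height alone, so [h] drops out of the difference quotient, and the
    right derivative of the smooth [v] is its derivative. *)
Lemma partial_psi_last n (M : Type) (A : atlas R n M) (h : M -> R) (v : R -> R)
    (psi : M * R -> R) (i : chart A) (y : 'rV[R]_(n + 1)) :
  smooth_on [set: R] v -> (forall p t, psi (p, t) = h p + v t) ->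
  partial (psi \o param (a := cyl_atlas A) i) y (rshift n 0) =
  derive1 v (y 0 (rshift n 0)).
Proof.
move=> sv hpsi.
have [B [ve [oB By Cve E]]] := sv (y 0 (rshift n 0)) I.
have dv : derivable v (y 0 (rshift n 0)) 1.
  have dve : derivable ve (y 0 (rshift n 0)) 1 by exact: Ck_derivable (Cve 1%N) By.
  apply: (@near_eq_derivable _ _ _ ve v _ _ _ dve).
  have : \forall z \near y 0 (rshift n 0), B z by exact: open_nbhs_nbhs.
  by apply: filterS => z Bz; rewrite E.
rewrite derive1E /derive cvg_at_rightE //.
rewrite /partial /rderive; set f := psi \o _; set y0 := y 0 _.
suff -> : (fun t : R => t^-1 *: (f (y + t *: delta_mx 0 (rshift n 0)) - f y)) =
    (fun t : R => t^-1 *: ((v \o shift y0) (t *: 1) - v y0)) by [].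
apply/funext => t; rewrite /f /y0.
rewrite /= !hpsi.
have -> : lsubmx (y + t *: delta_mx 0 (rshift n 0)) = lsubmx y.
  by rewrite addrC linearP /= lsubmx_delta_last scaler0 add0r.
have -> : rsubmx (y + t *: delta_mx 0 (rshift n 0)) 0 0 = t *: 1 + y 0 (rshift n 0).
  by rewrite !mxE !eqxx addrC.
have -> : rsubmx y 0 0 = y 0 (rshift n 0) by rewrite mxE.
by rewrite opprD addrACA subrr add0r.
Qed.

End CylinderCalculus.

(** * The height in an interior chart of the hypersurface *)

Section HeightEquation.
Variables (R : realType) (n : nat) (M : topologicalType) (A : atlas R n M).
Variables (g : metric A) (h : M -> R) (v : R -> R) (psi : M * R -> R).
Variables (S : topologicalType) (AS : atlas R n S) (iota : S -> M * R).
Variable N : chart (cyl_atlas A) -> S -> 'rV[R]_(n + 1).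
Variables (c : chart AS) (i : chart A).
Hypothesis n0 : (0 < n)%N.
Hypothesis codE : exists2 O : set 'rV[R]_n, open O & cod i = @half_space R n `&` O.
Hypothesis rg : is_riemannian g.
Hypothesis sh : smooth_fun A h.
Hypothesis sv : smooth_on [set: R] v.
Hypothesis psiE : forall p t, psi (p, t) = h p + v t.
Hypothesis imm : is_immersion AS (cyl_atlas A) iota.
Hypothesis nN : is_unit_normal AS (cyl_metric g) iota N.
Hypothesis minimal : weighted_minimal AS (cyl_metric g) psi iota N.
Hypothesis paramK : forall s, dom c s -> param c (Defs.coord c s) = s.
Variable U : set 'rV[R]_n.
Hypothesis oU : open U.
Hypothesis UL : U `<=` loc_dom iota c (i : chart (cyl_atlas A)).

Let last : 'I_(n + 1) := rshift n 0.
Let F := loc iota c (i : chart (cyl_atlas A)).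
Let AA : set 'rV[R]_(n + 1) := lsubmx @^-1` cod i.
Let Gc : 'rV[R]_(n + 1) -> 'M[R]_(n + 1) := cyl_metric g i.
Let G x := Gc (F x).
Let J x := jac F x.
Let D k := 'D_(delta_mx 0 k) F.
Let H x k l := 'D_(delta_mx 0 k) (D l) x.
Let dG x b := partial Gc (F x) b.
Let P x := invmx (J x *m G x *m (J x)^T).
Let Pv x := \row_a partial (psi \o param (a := cyl_atlas A) i) (F x) a.
Let Nv x := N i (param c x).
Let dN x k := partial (N i \o param c) x k.
Let u x := F x 0 last.

Let CkF k : Ck k U F.
Proof. by apply: smooth_on_open UL _ => //; case: (imm.2 c i). Qed.

Let CkNv k : Ck k U Nv.
Proof. by case: nN => _ sN _ _; apply: smooth_on_open UL _ => //; exact: sN. Qed.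

Let cF x : U x -> {for x, continuous F}.
Proof. exact: Ck_cont (CkF 0). Qed.

Let FAA x : U x -> AA (F x).
Proof.
move=> /UL[s [cs is_] <-]; rewrite /AA /F /loc paramK //=.
by rewrite row_mxKl; exists (iota s).1.
Qed.

Let nFAA x : U x -> \forall y \near x, AA (F y).
Proof.
move=> Ux; have : \forall y \near x, U y by exact: open_nbhs_nbhs.
by apply: filterS => y; exact: FAA.
Qed.

Let sAA : forward_stable AA.
Proof. by have [B oB E] := codE; exact: forward_stable_cyl oB E. Qed.

Let sGc : smooth_on AA Gc.
Proof. by apply: cyl_metric_smooth; case: rg. Qed.

Let sPsi : smooth_on AA (psi \o param (a := cyl_atlas A) i).
Proof. exact: cyl_psi_smooth sh sv psiE. Qed.

Let sym_Gc y : AA y -> (Gc y)^T = Gc y.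
Proof.
move=> Ay; rewrite /Gc /cyl_metric tr_block_mx !trmx0 trmx1.
by case: rg => _ + _ _ => ->.
Qed.

Let pos_Gc y : AA y -> posdef (Gc y).
Proof.
move=> Ay w w0; rewrite /Gc /cyl_metric -[w]hsubmxK mul_row_block tr_row_mx.
rewrite mul_row_col !mulmx0 addr0 add0r mulmx1 [X in 0 < X]mxE.
have gpos (z : 'rV[R]_n) : z != 0 -> 0 < (z *m g i (lsubmx y) *m z^T) 0 0.
  by case: rg => _ _ pg _; exact: (pg i (lsubmx y) Ay z).
have sq : (rsubmx w *m (rsubmx w)^T) 0 0 = (rsubmx w 0 0) ^+ 2.
  by rewrite mxE big_ord1 [X in _ * X]mxE expr2.
rewrite sq.
have [lw|lw] := eqVneq (lsubmx w) 0; last first.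
  by rewrite ltr_pwDl ?gpos // sqr_ge0.
rewrite lw !mul0mx [X in X + _]mxE add0r.
rewrite exprn_even_gt0 //=; apply: contra_neq w0 => rw.
rewrite -[w]hsubmxK lw.
have -> : rsubmx w = 0 by apply/rowP => j; rewrite ord1 rw mxE.
by rewrite row_mx0.
Qed.

Let Gc_last y : Gc y *m delta_mx last 0 = delta_mx last 0 :> 'cV_(n + 1).
Proof.
have -> : (delta_mx last 0 : 'cV[R]_(n + 1)) = col_mx 0 1%:M.
  apply/colP => k; rewrite -(fintype.splitK k).
  case: (fintype.split k) => j /=.
    by rewrite col_mxEu !mxE /last eq_lrshift.
  by rewrite col_mxEd !mxE /last eq_rshift andbT ord1.
by rewrite mul_block_col !mulmx0 mul0mx mulmx1 !add0r.
Qed.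

Let DE x k : U x -> row k (J x) = D k x.
Proof.
move=> Ux; apply/rowP => l; rewrite !mxE /partial.
rewrite (rderive_extension (A := U) (B := U) (fe := F)) //.
  exact: (open_forward_stable oU Ux).
exact: Ck_derivable (CkF 1) Ux.
Qed.

Let JE x k l : U x -> J x k l = D k x 0 l.
Proof. by move=> Ux; rewrite -DE // [RHS]mxE. Qed.

Let CkD k j : Ck j U (D k).
Proof. exact: (Ck_derive (delta_mx 0 k) (CkF j.+1)). Qed.

Let CkH k l j : Ck j U (fun x => H x k l).
Proof. exact: (Ck_derive (delta_mx 0 k) (CkD l j.+1)). Qed.

Let cont_entry p q (f : 'rV[R]_n -> 'M[R]_(p, q)) x a b :
  Ck 0 U f -> U x -> {for x, continuous (fun y => f y a b)}.
Proof. by move=> Cf Ux; exact: Ck_cont (Ck_entry a b oU Cf) Ux. Qed.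

Let near_U x : U x -> \forall y \near x, U y.
Proof. by move=> Ux; exact: open_nbhs_nbhs. Qed.

Let cont_J x k l : U x -> {for x, continuous (fun y => J y k l)}.
Proof.
move=> Ux; apply: (@near_eq_continuous _ _ (fun y => D k y 0 l)); last first.
  exact: cont_entry (CkD k 0) Ux.
by apply: filterS (near_U Ux) => y Uy; rewrite JE.
Qed.

Let cont_G x a b : U x -> {for x, continuous (fun y => G y a b)}.
Proof.
by move=> Ux; exact: smooth_comp_continuous0 (smooth_on_entry a b sGc) (cF Ux) (nFAA Ux).
Qed.

Let cont_dG x a b d : U x -> {for x, continuous (fun y => dG y a b d)}.
Proof.
move=> Ux.
have cp := smooth_comp_continuous (k := a) sAA (smooth_on_entry b d sGc) (cF Ux) (nFAA Ux).
apply: (near_eq_continuous _ cp); apply: filterS (near_U Ux) => y Uy.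
by rewrite /dG (partial_entry a b d sAA sGc (FAA Uy)).
Qed.

Let cont_Pv x a : U x -> {for x, continuous (fun y => Pv y 0 a)}.
Proof.
move=> Ux; have cp := smooth_comp_continuous (k := a) sAA sPsi (cF Ux) (nFAA Ux).
by apply: (near_eq_continuous _ cp); apply: filterS (near_U Ux) => y Uy; rewrite mxE.
Qed.

Let posJ x : U x -> posdef (J x *m G x *m (J x)^T).
Proof.
move=> Ux w w0.
have -> : w *m (J x *m G x *m (J x)^T) *m w^T = (w *m J x) *m G x *m (w *m J x)^T.
  by rewrite trmx_mul !mulmxA.
apply: pos_Gc; first exact: FAA.
have [_ rf] := imm.2 c i; have := rf x (UL Ux).
by rewrite -kermx_eq0 => /eqP k0; apply: contra_neq w0 => /sub_kermxP; rewrite k0 submx0 => /eqP.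
Qed.

Let symJ x : U x -> (J x *m G x *m (J x)^T)^T = J x *m G x *m (J x)^T.
Proof. by move=> Ux; rewrite !trmx_mul trmxK sym_Gc ?mulmxA //; exact: FAA. Qed.

Let symP x : U x -> (P x)^T = P x.
Proof. by move=> Ux; rewrite /P trmx_inv symJ. Qed.

Let posP x : U x -> posdef (P x).
Proof.
move=> Ux w w0; have uJ := posdef_unit (posJ Ux).
have -> : w *m P x *m w^T = (w *m P x) *m (J x *m G x *m (J x)^T) *m (w *m P x)^T.
  have -> : w *m P x *m (J x *m G x *m (J x)^T) = w.
    by rewrite -mulmxA (mulVmx uJ) mulmx1.
  by rewrite trmx_mul symP // mulmxA.
apply: posJ => //; apply: contra_neq w0 => wP.
by rewrite -[w]mulmx1 -(mulVmx uJ) mulmxA wP mul0mx.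
Qed.

Let cont_P x k l : U x -> {for x, continuous (fun y => P y k l)}.
Proof.
move=> Ux; apply: continuous_invmx; last exact: posdef_unit (posJ Ux).
move=> a b; apply: continuous_mulmx => [a' b'|a' b'].
  by apply: continuous_mulmx => *; [exact: cont_J|exact: cont_G].
rewrite (_ : (fun y => _) = fun y => J y b' a'); first exact: cont_J.
by apply/funext => y; rewrite mxE.
Qed.

Let T x := tension (J x) (G x) (dG x) (H x).

Let cont_T x e : U x -> {for x, continuous (fun y => T y 0 e)}.
Proof.
move=> Ux.
rewrite (_ : (fun y => _) = fun y => \sum_k \sum_l P y k l *
   ((\sum_a H y k l 0 a * G y a e) + \sum_b \sum_d J y k b * J y l d *
      (2^-1 * (dG y b e d + dG y d e b - dG y e b d)))).
  apply: continuous_big_sum => k; apply: continuous_big_sum => l.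
  apply: continuousM; first exact: cont_P.
  apply: continuousD.
    apply: continuous_big_sum => a; apply: continuousM; last exact: cont_G.
    exact: (@cont_entry _ _ (fun y => H y k l) _ _ _ (CkH k l 0) Ux).
  apply: continuous_big_sum => b; apply: continuous_big_sum => d.
  apply: continuousM; first by apply: continuousM; exact: cont_J.
  apply: continuousM; first exact: cst_continuous.
  by apply: continuousB; [apply: continuousD|]; exact: cont_dG.
apply/funext => y; rewrite /T /tension summxE; apply: eq_bigr => k _.
rewrite summxE; apply: eq_bigr => l _; rewrite [LHS]mxE; congr (_ * _).
rewrite [LHS]mxE [X in X + _]mxE summxE; congr (_ + _); apply: eq_bigr => b _.
by rewrite summxE; apply: eq_bigr => d _; rewrite !mxE.
Qed.

Let sym_dG x b : U x -> (dG x b)^T = dG x b.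
Proof.
move=> Ux; apply/matrixP => k l; rewrite mxE /dG.
rewrite !(partial_entry _ _ _ sAA sGc (FAA Ux)).
apply: (partial_eq_on b sAA (FAA Ux)) => z Az.
by rewrite -[in LHS](sym_Gc Az) mxE.
Qed.

Let Gc_const z k l : (k == last) || (l == last) -> Gc z k l = (k == l)%:R.
Proof.
have Gl m : Gc z m last = (m == last)%:R.
  have /(congr1 (fun X : 'cV[R]_(n + 1) => X m 0)) := Gc_last z.
  by rewrite -colE !mxE eqxx andbT.
have Gl' m : Gc z last m = (last == m)%:R.
  rewrite /Gc /cyl_metric /last -(fintype.splitK m) /=.
  case: (fintype.split m) => b /=.
    by rewrite block_mxEdl mxE eq_rlshift.
  by rewrite block_mxEdr mxE eq_rshift.
by move=> /orP[/eqP ->|/eqP ->].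
Qed.

Let dG_const x b k l : U x -> (k == last) || (l == last) -> dG x b k l = 0.
Proof.
move=> Ux kl; rewrite /dG (partial_entry b k l sAA sGc (FAA Ux)).
by apply: rderive_cst_along => t; rewrite !Gc_const.
Qed.

Let dG_last x : dG x last = 0.
Proof.
apply: rderive_cst_along => t; rewrite /Gc /cyl_metric.
by rewrite addrC linearP /= lsubmx_delta_last scaler0 add0r.
Qed.

(** Here the vertical field is seen to be parallel: the last row and column of the metric are
    constant, and the metric does not vary with the height. *)
Let christoffel_last x b d : U x -> christoffel1 (dG x) b d 0 last = 0.
Proof.
move=> Ux; apply: christoffel1_eq0; last exact: dG_last.
  by apply: dG_const => //; rewrite eqxx.
by apply: dG_const => //; rewrite eqxx.
Qed.

Let JN x : U x -> J x *m G x *m (Nv x)^T = 0.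
Proof.
move=> /[dup] Ux /UL[s [cs is_] sx]; apply/matrixP => k z; rewrite !ord1 [RHS]mxE.
have xs : param c x = s by rewrite -sx paramK.
case: nN => _ _ _ /(_ c i s cs is_ k); rewrite sx -/F -/(J x).
have -> : Defs.coord (a := cyl_atlas A) i (iota s) = F x by rewrite /F /loc xs.
rewrite /inner -/(G x) -row_mul -row_mul mxE /Nv xs; exact.
Qed.

Let NN x : U x -> Nv x *m G x *m (Nv x)^T = 1%:M.
Proof.
move=> /[dup] Ux /UL[s [cs is_] sx].
have xs : param c x = s by rewrite -sx paramK.
case: nN => _ _ /(_ i s is_) + _.
have -> : Defs.coord (a := cyl_atlas A) i (iota s) = F x by rewrite /F /loc xs.
by rewrite /inner -/(G x) -xs => E; rewrite [LHS]mx11_scalar E.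
Qed.

Let minN x : U x ->
  - (\sum_k \sum_l P x k l * inner (G x) (\row_al (dN x k 0 al + \sum_b \sum_d
      (\sum_(e < n + 1) 2^-1 * invmx (G x) al e * (dG x b e d + dG x d e b - dG x e b d))
       * J x k b * Nv x 0 d)) (row l (J x))) -
    inner (G x) (Pv x *m invmx (G x)) (Nv x) = 0.
Proof.
move=> /[dup] Ux /UL[s [cs is_] sx].
have xs : param c x = s by rewrite -sx paramK.
have := minimal cs is_; rewrite /weighted_mean_curvature sx -xs; exact.
Qed.

(** The orthogonality [JN] holds on all of [U], hence can be differentiated along the [k]-th
    coordinate. It is expanded into entries so that the metric along the immersion is handled by
    [smooth_comp_derive]. *)
Let diffN x k l : U x ->
  (H x k l *m G x *m (Nv x)^T) 0 0 +
  (row l (J x) *m (\sum_b J x k b *: dG x b) *m (Nv x)^T) 0 0 +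
  (row l (J x) *m G x *m (dN x k)^T) 0 0 = 0.
Proof.
move=> Ux.
pose f a b (y : 'rV[R]_n) := D l y 0 a * G y a b * Nv y 0 b.
have dNE b : dN x k 0 b = 'D_(delta_mx 0 k) (fun y => Nv y 0 b) x.
  rewrite /dN /partial (rderive_extension (A := U) (B := U) (fe := Nv)) //.
  - by rewrite derive_mx ?mxE //; exact: Ck_derivable (CkNv 1) Ux.
  - exact: (open_forward_stable oU Ux).
  - exact: Ck_derivable (CkNv 1) Ux.
have dG1 a b : is_derive x (delta_mx 0 k) (fun y => G y a b)
    (\sum_e J x k e * dG x e a b).
  have dF : derivable F x (delta_mx 0 k) by exact: Ck_derivable (CkF 1) Ux.
  have := smooth_comp_derive sAA (smooth_on_entry a b sGc) (cF Ux) (nFAA Ux) dF.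
  move=> HD; apply: is_derive_eq; apply: eq_bigr => e _.
  by rewrite JE // /dG (partial_entry e a b sAA sGc (FAA Ux)).
have dD a : is_derive x (delta_mx 0 k) (fun y => D l y 0 a) (H x k l 0 a).
  have dd : derivable (D l) x (delta_mx 0 k) by exact: Ck_derivable (CkD l 1) Ux.
  split; first by have /derivable_mxP := dd; apply.
  by rewrite /H derive_mx ?mxE.
have dNv b : is_derive x (delta_mx 0 k) (fun y => Nv y 0 b) (dN x k 0 b).
  rewrite dNE; apply: derivableP.
  by have /derivable_mxP := Ck_derivable (v := delta_mx 0 k) (CkNv 1) Ux; apply.
have df a b : is_derive x (delta_mx 0 k) (f a b)
  ((H x k l 0 a * G x a b + D l x 0 a * (\sum_e J x k e * dG x e a b)) * Nv x 0 b
   + D l x 0 a * G x a b * dN x k 0 b).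
  have d1 : is_derive x (delta_mx 0 k) (fun y => D l y 0 a * G y a b)
      (H x k l 0 a * G x a b + D l x 0 a * (\sum_e J x k e * dG x e a b)).
    apply: (is_derive_eq (is_deriveM (dD a) (dG1 a b))).
    by rewrite /GRing.scale /= addrC mulrC; congr (_ + _); rewrite mulrC.
  have d2 := is_deriveM d1 (dNv b).
  by apply: (is_derive_eq d2); rewrite /GRing.scale /= addrC; congr (_ + _); rewrite mulrC.
have ds := is_derive_sum (fun a => is_derive_sum (df a)).
have Z : {near x, (\sum_a \sum_b f a b) =1 cst 0}.
  apply: filterS (near_U Ux) => y Uy.
  have /(congr1 (fun X : 'cV[R]_n => X l 0)) := JN Uy.
  rewrite [RHS]mxE => E; rewrite /cst -[RHS]E.
  have -> : (J y *m G y *m (Nv y)^T) l 0 = (D l y *m G y *m (Nv y)^T) 0 0.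
    by rewrite -DE // -!row_mul [RHS]mxE.
  rewrite bilinear_formE fct_sumE; apply: eq_bigr => a _.
  by rewrite fct_sumE.
have [_ ds0] := ds.
have D0 : 'D_(delta_mx 0 k) (\sum_a \sum_b f a b) x = 0.
  by rewrite (near_eq_derive _ Z) derive_cst.
rewrite DE // !bilinear_formE -[RHS]D0 ds0 -!big_split; apply: eq_bigr => a _ /=.
rewrite -!big_split; apply: eq_bigr => b _ /=.
have -> : (\sum_e J x k e *: dG x e) a b = \sum_e J x k e * dG x e a b.
  by rewrite summxE; apply: eq_bigr => e _; rewrite mxE.
by ring.
Qed.

(** These are the coefficients of the tangential remainder of [tension_equation], moved to the side
    of the second order terms. *)
Let drift x := - ((T x - Pv x) *m (J x)^T *m P x).

(** In [tension_equation] for the vertical vector, the Christoffel terms on the left vanish, which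
    leaves the second derivatives of [u]; on the right, [Pv] contributes [v'(u)]. *)
Lemma height_equation_aux :
  [/\ Ck 2 U u,
    (forall x k l, U x -> {for x, continuous (fun z => P z k l)}),
    (forall x k, U x -> {for x, continuous (fun z => drift z 0 k)}),
    (forall x, U x -> (P x)^T = P x /\ posdef (P x)) &
    forall x, U x ->
     \sum_k \sum_l P x k l * 'D_(delta_mx 0 k) ('D_(delta_mx 0 l) u) x +
     \sum_k drift x 0 k * 'D_(delta_mx 0 k) u x = derive1 v (u x)].
Proof.
split.
- exact: Ck_entry.
- by move=> x k l; exact: cont_P.
- move=> x k Ux.
  rewrite (_ : (fun z => _) = fun z => - ((T z - Pv z) *m (J z)^T *m P z) 0 k); last first.
    by apply/funext => z; rewrite mxE.
  apply: continuousN; apply: continuous_mulmx => [a b|a b]; last exact: cont_P.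
  apply: continuous_mulmx => [a' b'|a' b'].
    rewrite (_ : (fun z => _) = (fun z => T z 0 b') - (fun z => Pv z 0 b')).
      by apply: continuousB; [exact: cont_T|exact: cont_Pv].
    by apply/funext => z; rewrite ord1 [LHS]mxE [X in _ + X = _]mxE.
  rewrite (_ : (fun y => _) = fun y => J y b' a'); first exact: cont_J.
  by apply/funext => y; rewrite mxE.
- by move=> x Ux; split; [exact: symP|exact: posP].
move=> x Ux.
have E := tension_equation (sym_Gc (FAA Ux)) (posdef_unit (pos_Gc (FAA Ux)))
  (posdef_unit (posJ Ux)) (JN Ux) (NN Ux) (fun b => sym_dG b Ux)
  (fun k l => diffN k l Ux) (minN Ux) (Gc_last (F x)).
have Du k y : U y -> 'D_(delta_mx 0 k) u y = D k y 0 last.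
  by move=> Uy; rewrite /D derive_mx ?mxE //; exact: Ck_derivable (CkF 1) Uy.
have DDu k l : 'D_(delta_mx 0 k) ('D_(delta_mx 0 l) u) x = H x k l 0 last.
  have nE : {near x, 'D_(delta_mx 0 l) u =1 fun y => D l y 0 last}.
    by apply: filterS (near_U Ux) => y Uy; exact: Du.
  rewrite (near_eq_derive _ nE) /H derive_mx ?mxE //.
  exact: Ck_derivable (CkD l 1) Ux.
have lastE (w : 'rV[R]_(n + 1)) : (w *m (delta_mx last 0 : 'cV[R]_(n + 1))) 0 0 = w 0 last.
  by rewrite -colE mxE.
have TE : (T x *m (delta_mx last 0 : 'cV[R]_(n + 1))) 0 0 = \sum_k \sum_l P x k l * H x k l 0 last.
  rewrite lastE /T /tension summxE; apply: eq_bigr => k _.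
  rewrite summxE; apply: eq_bigr => l _; rewrite [LHS]mxE; congr (_ * _).
  rewrite -lastE mulmxDl -mulmxA Gc_last [LHS]mxE lastE -[RHS]addr0; congr (_ + _).
  rewrite lastE summxE big1 // => b _; rewrite summxE big1 // => d _.
  by rewrite mxE christoffel_last // mulr0.
under eq_bigr => k _ do under eq_bigr => l _ do rewrite DDu.
rewrite -TE E lastE.
have -> : Pv x 0 last = derive1 v (u x).
  by rewrite mxE (partial_psi_last i _ sv psiE).
have -> : \sum_k drift x 0 k * 'D_(delta_mx 0 k) u x =
    - ((T x - Pv x) *m (J x)^T *m P x *m (J x *m (delta_mx last 0 : 'cV[R]_(n + 1)))) 0 0.
  rewrite [X in - X]mxE -sumrN; apply: eq_bigr => k _.
  have -> : (J x *m (delta_mx last 0 : 'cV[R]_(n + 1))) k 0 = D k x 0 last.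
    by rewrite -colE [LHS]mxE JE.
  have -> : drift x 0 k = - ((T x - Pv x) *m (J x)^T *m P x) 0 k by rewrite [LHS]mxE.
  by rewrite Du // mulNr.
by rewrite addrK.
Qed.

End HeightEquation.

(** * Rigidity *)

(** In the half-space, a nonzero coordinate of index 0 is positive, and positivity is an open
    condition of the whole space; continuity of [iota] then keeps the image inside the domain of
    [i]. *)
Lemma open_interior_chart (R : realType) (n : nat) (M : topologicalType)
    (A : atlas R n M) (S : topologicalType) (AS : atlas R n S)
    (iota : S -> M * R) (c : chart AS) (i : chart A) (s : S) (k : 'I_n) :
  is_manifold A -> is_manifold AS -> continuous iota -> dom c s -> dom i (iota s).1 ->
  val k = 0%N -> Defs.coord c s 0 k != 0 ->
  exists U : set 'rV[R]_n, [/\ open U, U (Defs.coord c s) &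
    U `<=` loc_dom iota c (i : chart (cyl_atlas A))].
Proof.
move=> [_ _ _ /(_ i)[oi _ _ _ _] _] [_ _ _ /(_ c)[oc [B oB codE] pK _ cp] _] ci cs is_ k0 sk.
pose W := [set x : 'rV[R]_n | 0 < x 0 k] `&` B.
have oW : open W.
  apply: openI => //; apply: (@open_comp _ _ (fun x : 'rV[R]_n => x 0 k) [set t | 0 < t]).
    by move=> x _; exact: coord_continuous.
  exact: open_gt.
have Wc : W `<=` cod c.
  move=> x [/= xk Bx]; rewrite codE; split=> // j j0.
  by rewrite (_ : j = k) ?ltW //; apply: val_inj; rewrite /= j0 k0.
have cW x : W x -> {for x, continuous (fun y => (iota (param c y)).1)}.
  move=> Wx; have cpx : {for x, continuous (param c)}.
    have : {within W, continuous (param c)} by exact: continuous_subspaceW cp.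
    by rewrite continuous_open_subspace // => /(_ x (mem_set Wx)).
  have ci2 : {for x, continuous (iota \o param c)}.
    by apply: continuous_comp => //; exact: ci.
  exact: (continuous_comp ci2 (@cvg_fst _ _ _ _ _)).
exists (W `&` [set x | dom i (iota (param c x)).1]); split.
- rewrite openE => x [Wx ix]; apply: (@filterI _ (nbhs x)).
    exact: open_nbhs_nbhs.
  by apply: (cW x Wx); exact: open_nbhs_nbhs.
- have cods : cod c (Defs.coord c s) by exists s.
  split; last by rewrite /= pK.
  move: cods; rewrite codE => -[hs Bs]; split=> //=.
  by rewrite lt_def sk hs.
- move=> x [/Wc[p cp' <-]] /=; rewrite pK // => ip.
  by exists p.
Qed.

(* The sign [e] is [1] in case (i) and [-1] in case (ii). *)
Lemma height_rigidity (R : realType) (n : nat) (M : topologicalType)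
    (A : atlas R n M) (g : metric A) (h : M -> R) (v : R -> R) (psi : M * R -> R)
    (S : topologicalType) (AS : atlas R n S) (iota : S -> M * R)
    (N : chart (cyl_atlas A) -> S -> 'rV[R]_(n + 1)) (a e : R) :
  (0 < n)%N -> is_manifold A -> is_riemannian g ->
  smooth_fun A h -> smooth_on [set: R] v ->
  (forall p t, psi (p, t) = h p + v t) ->
  is_manifold AS -> is_immersion AS (cyl_atlas A) iota ->
  is_unit_normal AS (cyl_metric g) iota N ->
  compact [set: S] -> connected [set: S] ->
  weighted_minimal AS (cyl_metric g) psi iota N ->
  boundary AS !=set0 -> e != 0 ->
  (forall s, e * (iota s).2 <= e * a) ->
  (forall s, e * derive1 v (iota s).2 <= 0) ->
  (forall s, boundary AS s -> (iota s).2 = a) ->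
  (forall s, (iota s).2 = a) /\ derive1 v a = 0.
Proof.
move=> n0 mA rg sh sv psiE mS imm nN cS conS minimal bd e0 ua va ba.
pose last : 'I_(n + 1) := rshift n 0.
pose k0 : 'I_n := Ordinal n0.
have ci : continuous iota := imm.1.
have pK (c : chart AS) s : dom c s -> param c (Defs.coord c s) = s.
  by have [_ _ _ /(_ c)[_ _ pK _ _] _] := mS; exact: pK.
have cdE (i : chart A) : exists2 B : set 'rV[R]_n, open B & cod i = @half_space R n `&` B.
  by have [_ _ _ /(_ i)[_ cdE _ _ _] _] := mA.
pose u (c : chart AS) (i : chart A) x :=
  loc iota c (i : chart (cyl_atlas A)) x 0 last.
have uE c i x : u c i x = (iota (param c x)).2.
  by rewrite /u /loc /= row_mxEr mxE.
have eqn (c : chart AS) (i : chart A) U (oU : open U)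
    (UL : U `<=` loc_dom iota c (i : chart (cyl_atlas A))) :=
  height_equation_aux n0 (cdE i) rg sh sv psiE imm nN minimal (@pK c) oU UL.
pose w s := e * (iota s).2.
have cw : continuous w.
  move=> s; apply: (@continuousM _ _ (cst e) (fun s => (iota s).2)).
    exact: cst_continuous.
  exact: (continuous_comp (ci s) (@cvg_snd _ _ _ _ _)).
have [s0 bs0] := bd.
have [s1 _ wmin] : exists2 s1, s1 \in [set: S] & forall t, t \in [set: S] -> w s1 <= w t.
  by apply: compact_EVT_min => //; [exists s0|exact: continuous_subspaceT].
have {}wmin t : w s1 <= w t by apply: wmin; rewrite inE.
have ws1 : w s1 = e * a.
  apply/eqP/negPn/negP => /eqP w1.
  pose Z := [set s | w s = w s1].
  have ZT : Z = [set: S].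
    apply: conS; first by exists s1.
      exists Z; last by rewrite setTI.
      rewrite openE => s Zs.
      have nbs : ~ boundary AS s by move=> /ba sa; apply: w1; rewrite -Zs /w sa.
      have [_ _ /(_ s)[c cs] _ _] := mS.
      have [_ _ /(_ (iota s).1)[i is_] _ _] := mA.
      have ck : Defs.coord c s 0 k0 != 0.
        by apply/eqP => ck; apply: nbs; exists c => //; exists k0.
      have [U [oU Us UL]] := open_interior_chart mA mS ci cs is_ (erefl : val k0 = 0%N) ck.
      have [Cu cP cb sP Lu] := eqn c i U oU UL.
      pose u' x := e *: u c i x.
      have Du' x k : U x -> 'D_(delta_mx 0 k) u' x = e *: 'D_(delta_mx 0 k) (u c i) x.
        by move=> Ux; apply: deriveZ; exact: Ck_derivable Cu Ux.
      have DDu' x k l : U x -> 'D_(delta_mx 0 k) ('D_(delta_mx 0 l) u') x =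
          e *: 'D_(delta_mx 0 k) ('D_(delta_mx 0 l) (u c i)) x.
        move=> Ux.
        have E : {near x, 'D_(delta_mx 0 l) u' =1 fun y => e *: 'D_(delta_mx 0 l) (u c i) y}.
          have : \forall y \near x, U y by exact: open_nbhs_nbhs.
          by apply: filterS => y; exact: Du'.
        rewrite (near_eq_derive _ E); apply: deriveZ.
        exact: Ck_derivable (Ck_derive _ Cu) Ux.
      have H : \forall x \near Defs.coord c s, u' x = w s1.
        have Cu' : Ck 2 U u' by exact: (@CkZ _ _ _ 2 U (u c i) e oU Cu).
        apply: (@strong_minimum_principle _ _ U u' _ _ (w s1) _ oU Cu' cP cb).
        - by move=> x /sP[].
        - by move=> x /sP[].
        - move=> x Ux.
          (* By linearity the left side is [e] times the equation of the height, so this comparison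
             is in fact an equality and the sign comes from [va]. *)
          apply: le_trans (va (param c x)); rewrite -(uE c i) -(Lu x Ux) mulrDr !mulr_sumr.
          rewrite le_eqVlt; apply/orP; left; apply/eqP.
          congr (_ + _); apply: eq_bigr => k _; last first.
            by rewrite Du' //; exact: mulrCA.
          rewrite mulr_sumr; apply: eq_bigr => l _.
          by rewrite DDu' //; exact: mulrCA.
        - by move=> x Ux; rewrite /u' uE; exact: wmin.
        - exact: Us.
        - by rewrite /u' uE pK.
      have [_ _ _ /(_ c)[oc _ _ cc _] _] := mS.
      have ccs : {for s, continuous (Defs.coord c)}.
        by move: cc; rewrite continuous_open_subspace // => /(_ s (mem_set cs)).
      have nc : \forall t \near s, dom c t by exact: open_nbhs_nbhs.
      have := ccs _ H; apply: filterS2 nc => t ct /=.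
      by rewrite /u' uE pK.
    exists Z; last by rewrite setTI.
    apply: (@closed_comp _ _ w [set t | t = w s1]); first by move=> s _; exact: cw.
    exact: closed_eq.
  have : Z s0 by rewrite ZT.
  by rewrite /Z /= => Z0; apply: w1; rewrite -Z0 /w (ba _ bs0).
have ua' s : (iota s).2 = a.
  apply: (mulfI e0); apply/eqP; rewrite eq_le ua /= -ws1; exact: wmin.
split=> //.
(* The equation is read at an interior point [s'], found by moving from the boundary point [s0] a
   little along the coordinate of index 0, which keeps it in the same chart. *)
have [_ _ /(_ s0)[c cs0] _ _] := mS.
have [_ _ _ /(_ c)[_ [B oB cE] _ _ _] _] := mS.
have cod0 : (@half_space R n `&` B) (Defs.coord c s0) by rewrite -cE; exists s0.
have st := half_space_forward_stable oB cod0 k0.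
have st2 : \forall t \near (0 : R)^'+, 0 < t by exact: nbhs_right_gt.
have [t [t0 ht]] := filter_ex (filterI st2 st).
have [s' cs' sE] : cod c (Defs.coord c s0 + t *: delta_mx 0 k0) by rewrite cE.
have [_ _ /(_ (iota s').1)[i is_] _ _] := mA.
have ck : Defs.coord c s' 0 k0 != 0.
  rewrite sE !mxE !eqxx mulr1 gt_eqF // ltr_wpDl //.
  by case: cod0 => + _; apply.
have [U [oU Us UL]] := open_interior_chart mA mS ci cs' is_ (erefl : val k0 = 0%N) ck.
have [Cu cP cb sP Lu] := eqn c i U oU UL.
have D0 x l : U x -> 'D_(delta_mx 0 l) (u c i) x = 0.
  (* [param c] is total with values in the hypersurface, so [u c i] is constant on the whole
     coordinate space, even off the image of the chart. *)
  move=> Ux; rewrite (_ : u c i = cst a) ?derive_cst //.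
  by apply/funext => y; rewrite uE ua'.
have := Lu _ Us; rewrite -/(u c i) -[loc _ _ _ _ _ _]/(u c i _) uE ua' => <-.
rewrite [X in _ + X]big1 ?addr0; last by move=> k _; rewrite D0 ?mulr0.
rewrite big1 // => k _; rewrite big1 // => l _.
have E : {near Defs.coord c s', 'D_(delta_mx 0 l) (u c i) =1 cst 0}.
  have : \forall y \near Defs.coord c s', U y by exact: open_nbhs_nbhs.
  by apply: filterS => y; exact: D0.
by rewrite (near_eq_derive _ E) derive_cst mulr0.
Qed.

Theorem proposition3p9 (R : realType) (n : nat)
  (M : topologicalType) (A : atlas R n M) (g : metric A)
  (o : chart A -> M -> R)
  (hn : (0 < n)%N)
  (hM : is_manifold A) (hg : is_riemannian g)
  (hMcomplete : riemannian_complete g) (hMconn : connected [set: M])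
  (hMor : is_orientation o)
  (h : M -> R) (v : R -> R) (psi : M * R -> R)
  (hh : smooth_fun A h) (hv : smooth_on [set: R] v)
  (hpsi : forall p t, expR (psi (p, t)) = expR (h p) * expR (v t))
  (S : topologicalType) (AS : atlas R n S) (iota : S -> M * R)
  (N : chart (cyl_atlas A) -> S -> 'rV[R]_(n + 1))
  (hS : is_manifold AS) (hiota : is_immersion AS (cyl_atlas A) iota)
  (hN : is_unit_normal AS (cyl_metric g) iota N)
  (hScompact : compact [set: S]) (hSconn : connected [set: S])
  (hmin : weighted_minimal AS (cyl_metric g) psi iota N)
  (hbd : boundary AS !=set0)
  (a : R)
  (hcond :
    [/\ range iota `<=` [set q | height q <= a],
        (forall q, range iota q -> derive1 v (height q) <= 0) &
        iota @` boundary AS `<=` slice a] \/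
    [/\ range iota `<=` [set q | a <= height q],
        (forall q, range iota q -> 0 <= derive1 v (height q)) &
        iota @` boundary AS `<=` slice a]) :
  range iota `<=` slice a /\ derive1 v a = 0.
Proof.
have psiE p t : psi (p, t) = h p + v t.
  by apply: expR_inj; rewrite expRD; exact: hpsi.
have [[ua va ba]|[ua va ba]] := hcond.
  have [||s sb|H1 H2] := @height_rigidity R n M A g h v psi S AS iota N a 1
    hn hM hg hh hv psiE hS hiota hN hScompact hSconn hmin hbd (oner_neq0 _).
  - by move=> s; rewrite !mul1r; apply: ua; exists s.
  - by move=> s; rewrite mul1r; apply: va; exists s.
  - by apply: ba; exists s.
  by split=> // _ [s _ <-]; exact: H1.
have [|||s sb|H1 H2] := @height_rigidity R n M A g h v psi S AS iota N a (-1)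
  hn hM hg hh hv psiE hS hiota hN hScompact hSconn hmin hbd.
- by rewrite oppr_eq0 oner_eq0.
- by move=> s; rewrite !mulN1r lerN2; apply: ua; exists s.
- by move=> s; rewrite mulN1r oppr_le0; apply: va; exists s.
- by apply: ba; exists s.
by split=> // _ [s _ <-]; exact: H1.
Qed.
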